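(* Let $\ell_1,\ell_2\in\mathbb{N}\setminus\{1\}$ satisfy $\gcd(\ell_1,\ell_2)=1$, and let $$p(x,y):=xy\bigl(x^{\ell_1}y^{\ell_2}-1\bigr).$$ Then, for every $n\ge\ell_1+\ell_2+2$, the generator family $\{1,p,-p\}$ satisfies property $\left(S_{n,\,2(\ell_1+\ell_2)}\right)$.
   Context: Here $\mathbb{N}=\{1,2,\ldots\}$, $\mathbb{N}_0=\mathbb{N}\cup\{0\}$, $\mathcal{P}_m=\{f\in\mathbb{R}[x,y]:\deg f\le m\}$, and $\mathcal{Z}_p=\{(x,y)\in\mathbb{R}^2:p(x,y)=0\}$. A truncated (bivariate) sequence of degree $2n$ is a family of real numbers $\beta\equiv\beta^{(2n)}=\{\beta_{i,j}\}_{i,j\in\mathbb{N}_0,\,i+j\le 2n}$. Its Riesz functional is the linear map $L_\beta:\mathcal{P}_{2n}\to\mathbb{R}$ with $L_\beta(x^iy^j)=\beta_{i,j}$. Let $\mathcal{B}_m$ denote the set of monomials of degree at most $m$. The moment matrix $M(n)\equiv M(n;\beta)$ is the symmetric matrix indexed by $\mathcal{B}_n\times\mathcal{B}_n$ whose entry at monomials $(u,v)$ is $L_\beta(uv)$. For a polynomial $q$ of degree $\delta\le 2n$, the localizing matrix $M_q(n)\equiv M_q(n;\beta)$ is the symmetric matrix indexed by $\mathcal{B}_{n-\lceil\delta/2\rceil}\times\mathcal{B}_{n-\lceil\delta/2\rceil}$ whose entry at $(u,v)$ is $L_\beta(quv)$. For $k\in\mathbb{N}_0$, a positive extension of $M(n)$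 of order $n+k$ is a moment matrix $M(n+k)\succeq 0$ (of some truncated sequence of degree $2(n+k)$) whose principal submatrix indexed by $\mathcal{B}_n$ equals $M(n)$. Let $Q=\{q_0:=1,q_1,\ldots,q_m\}\subset\mathbb{R}[x,y]$ and $K_Q=\{z\in\mathbb{R}^2:q_i(z)\ge 0,\ i=0,\ldots,m\}$. A $K_Q$-representing measure for $\beta^{(2n)}$ is a positive Borel measure $\mu$ on $\mathbb{R}^2$ supported on $K_Q$ with $\beta_{i,j}=\int x^iy^j\,d\mu$ for all $i+j\le 2n$. The family $Q$ satisfies property $(S_{n,k})$ if, for every truncated sequence $\beta^{(2n)}$ of degree $2n$: $\beta^{(2n)}$ has a $K_Q$-representing measure if and only if $M(n)$ admits a positive extension $M(n+k)$ such that $M_{q_i}(n+k)\succeq 0$ for $i=1,\ldots,m$. For $Q=\{1,p,-p\}$ one has $K_Q=\mathcal{Z}_p$. *)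

(* Defs.v *)
From HB Require Import structures.
From mathcomp Require Import all_boot all_order all_algebra.
From mathcomp Require Import all_classical all_reals all_analysis.
From mathcomp Require mpoly.
(* The notations of mpoly clash with those of MathComp-Analysis. *)
Import -(notations) mpoly.

Set Implicit Arguments.
Unset Strict Implicit.
Unset Printing Implicit Defensive.

Import Order.TTheory GRing.Theory Num.Theory.
Import numFieldNormedType.Exports.

Local Open Scope classical_set_scope.
Local Open Scope ring_scope.

(* The plane R^2; the product sigma-algebra of the Borel sigma-algebra with
   itself is the Borel sigma-algebra of the plane. *)
Notation plane R := (measurableTypeR R * measurableTypeR R)%type.

Notation bipoly R := (mpoly 2 R).

Definition polX {R : nzRingType} : bipoly R := mpolyX R (mnm1 ord0).
Definition polY {R : nzRingType} : bipoly R := mpolyX R (mnm1 ord_max).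

(* [mpoly.msize] is 1 + the total degree for a nonzero polynomial. *)
Definition deg {R : nzRingType} (q : bipoly R) : nat := (mpoly.msize q).-1.

(* [monomials m] is the finite type of the exponents of the monomials of
   total degree at most m; the exponent of x^i y^j sends [ord0] to i and
   [ord_max] to j. *)
Notation monomials m := (bmultinom 2 m.+1).

Definition mon {R : nzRingType} {m : nat} (u : monomials m) : bipoly R :=
  mpolyX R (bmnm u).

Definition evalp {R : realType} (q : bipoly R) (z : plane R) : R :=
  meval (fun i : 'I_2 => if i == ord0 then z.1 else z.2) q.

Definition psd {R : realType} {d : nat} (A : 'M[R]_d) : Prop :=
  A^T = A /\ forall v : 'cV[R]_d, 0 <= (v^T *m A *m v) ord0 ord0.

(* Truncated sequences of degree 2n: beta_{i,j} is indexed by the exponent of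
   the monomial x^i y^j, with i + j <= 2n. *)
Definition trunc_seq (R : realType) (n : nat) : Type := monomials (2 * n) -> R.

(* The Riesz functional; it is only meaningful on polynomials of degree at most
   2n, the terms of higher degree being ignored. *)
Definition riesz {R : realType} {n : nat} (beta : trunc_seq R n)
    (q : bipoly R) : R :=
  \sum_(m : monomials (2 * n)) mcoeff (bmnm m) q * beta m.

Definition moment_matrix {R : realType} {n : nat} (beta : trunc_seq R n) :
    'M[R]_#|{: monomials n}| :=
  \matrix_(i, j) riesz beta (mon (enum_val i) * mon (enum_val j)).

(* Meaningful when deg q <= 2n. *)
Definition localizing_matrix {R : realType} {n : nat} (beta : trunc_seq R n)
    (q : bipoly R) : 'M[R]_#|{: monomials (n - uphalf (deg q))}| :=
  \matrix_(i, j) riesz beta (q * mon (enum_val i) * mon (enum_val j)).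

Lemma monomials_widen_subproof (n k : nat) (u : monomials n) :
  (mdeg (bmnm u) < (n + k).+1)%N.
Proof. by rewrite (leq_trans (bmdeg u))// ltnS leq_addr. Qed.

Definition monomials_widen (n k : nat) (u : monomials n) : monomials (n + k) :=
  BMultinom (monomials_widen_subproof k u).

Definition widen_index (n k : nat) (i : 'I_#|{: monomials n}|) :
    'I_#|{: monomials (n + k)}| :=
  enum_rank (monomials_widen k (enum_val i)).

(* M(n+k) = [moment_matrix gamma] is a positive extension of
   M(n) = [moment_matrix beta]. *)
Definition positive_extension {R : realType} {n k : nat}
    (beta : trunc_seq R n) (gamma : trunc_seq R (n + k)) : Prop :=
  psd (moment_matrix gamma) /\
  mxsub (@widen_index n k) (@widen_index n k) (moment_matrix gamma) =
    moment_matrix beta.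

Definition semialg {R : realType} (Q : seq (bipoly R)) : set (plane R) :=
  [set z | forall q, q \in Q -> 0 <= evalp q z].

(* "Supported on K_Q" means that the complement of the (closed) set K_Q is
   null; the moments are required to exist as Lebesgue integrals. *)
Definition representing_measure {R : realType} {n : nat}
    (Q : seq (bipoly R)) (beta : trunc_seq R n)
    (mu : {measure set (plane R) -> \bar R}) : Prop :=
  mu (~` semialg Q) = 0%E /\
  forall m : monomials (2 * n),
    mu.-integrable setT
      (fun z => (z.1 ^+ bmnm m ord0 * z.2 ^+ bmnm m ord_max)%:E) /\
    (\int[mu]_z (z.1 ^+ bmnm m ord0 * z.2 ^+ bmnm m ord_max)%:E)%E =
      (beta m)%:E.

(* Q is the list [:: q_0; q_1; ...; q_m] with q_0 = 1; the localizing condition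
   is imposed on q_1, ..., q_m only. *)
Definition property_S {R : realType} (Q : seq (bipoly R)) (n k : nat) : Prop :=
  forall beta : trunc_seq R n,
    (exists mu : {measure set (plane R) -> \bar R},
        representing_measure Q beta mu) <->
    (exists gamma : trunc_seq R (n + k),
        positive_extension beta gamma /\
        forall i, (0 < i < size Q)%N -> psd (localizing_matrix gamma Q`_i)).

(* Main.v *)
From HB Require Import structures.
Require Import Defs.
From mathcomp Require Import all_boot all_order all_algebra.
From mathcomp Require Import all_classical all_reals all_analysis.
From mathcomp Require mpoly.
Import -(notations) mpoly.
From mathcomp Require complex.
Import -(notations) complex.
From mathcomp Require Import measurable_realfun ring lra zify.

(** The idea of the proof.

    Put [d = l1 + l2] and [e = x^l1 y^l2].  Modulo [p] the polynomial [e] is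
    idempotent, since [e - e^2 = - x^(l1-1) y^(l2-1) p]; it is 0 on the two
    axes and 1 on the curve [x^l1 y^l2 = 1], which together form the zero set
    of [p].

    From extension to measure.  Let [L] be the Riesz functional of a positive
    extension of order [n + 2d].  The two localizing conditions make [L] vanish
    on the multiples of [p], up to a degree that depends on the parity of [d].
    Hence [L] is the sum of [f |-> L (e f)] and [f |-> L ((1 - e) f)], and as
    [L (e f^2) = L ((e f)^2)], and likewise for [1 - e], both are positive on
    squares of polynomials of degree at most [n + d - 2].  The extra [2d]
    degrees suffice because multiplication by [e] costs [d] degrees, and the
    curve costs [d - 2] more, as follows ([plane_moments_atomic]).
    - The curve is parametrized by [x = t^l2], [y = t^-l1] with [t != 0].  As
      [l1] and [l2] are coprime, every exponent [k] with
      [- n l1 - 1 <= k <= n l2 + 1] is [i l2 - j l1] with [i + j <= n + d - 2].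
      So the first functional gives a positive semidefinite Hankel form on
      these powers of [t] ([curve_moments_atomic]).
    - The second functional kills [x y f], hence is a functional on pairs of
      univariate polynomials with a common constant term.  Its value at 1 can
      be divided between the two axes so that both univariate forms remain
      positive semidefinite ([axes_moments_atomic]).
    In both cases the truncated Hamburger theorem applies: a positive
    semidefinite Hankel form of size [K + 1] is integration against a finitely
    atomic measure in degrees less than [2 K] ([truncated_hamburger]).  The
    loss of the top degree is harmless, because the forms above are available
    at least one degree beyond what is needed, at both ends for the Laurent polynomials.

    The Hamburger theorem is proved by Gauss quadrature.  There is a monic
    polynomial [q] of some degree [r <= K] orthogonal to everything of degree
    less than [2 K - r], such that the form is definite below degree [r].  Such
    a [q] has simple real roots, for otherwise [q = ((X - a)^2 + b^2) q1] and
    [0 = L (q q1) = L (((X - a) q1)^2) + b^2 L (q1^2) > 0].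

    From measure to extension.  Moments of higher order of the given measure
    may fail to exist, so the measure is first replaced by a finitely atomic
    one on the same closed set with the same moments up to degree [2n]
    ([integral_atomic], the theorem of Richter and Tchakaloff); the moments of
    the latter form the extension.  Its proof is an induction on the number of
    integrands that rests on the weak separation of a point from a convex cone
    in finite dimension ([convex_cone_halfspace]). *)

Set Implicit Arguments.
Unset Strict Implicit.
Unset Printing Implicit Defensive.

Import Order.TTheory GRing.Theory Num.Theory.

Local Open Scope ring_scope.

(** * Convex cones and finitely atomic measures *)

(** A convex cone that is not the whole space lies in a half-space, whether or
    not it is closed.  Induction on the dimension: unless the hyperplane [x_0 = 0]
    lies in the cone, a functional that is nonnegative on the trace of the cone
    on that hyperplane extends to the cone, as in the theorem of M. Riesz, by
    choosing its value at the first basis vector between a supremum and an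
    infimum, both of which are taken over nonempty sets unless [x_0] has a
    constant sign on the cone. *)
Lemma convex_cone_halfspace (R : realType) (m : nat) (D : set 'rV[R]_m) :
  D 0 -> (forall u v, D u -> D v -> D (u + v)) ->
  (forall t v, 0 <= t -> D v -> D (t *: v)) -> (exists x, ~ D x) ->
  exists2 f : 'cV[R]_m, f != 0 & forall v, D v -> 0 <= (v *m f) 0 0.
Proof.
elim: m D => [|m IHm] D D0 DD DZ [x Dx]; first by case: Dx; rewrite [x]thinmx0.
pose e : 'rV[R]_(1 + m) := row_mx 1 0.
pose emb (h : 'rV[R]_m) : 'rV[R]_(1 + m) := row_mx 0 h.
pose hd (v : 'rV[R]_(1 + m)) := lsubmx v 0 0.
pose tl (v : 'rV[R]_(1 + m)) := rsubmx v.
have decomp (v : 'rV[R]_(1 + m)) : v = hd v *: e + emb (tl v).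
  rewrite -[LHS]hsubmxK scale_row_mx add_row_mx scaler0 addr0 add0r; congr row_mx.
  by rewrite [LHS]mx11_scalar -scalemx1.
have top (a : R) (f : 'cV[R]_m) (v : 'rV[R]_(1 + m)) :
    (v *m (col_mx a%:M f : 'cV_(1 + m))) 0 0 = hd v * a + (tl v *m f) 0 0.
  by rewrite -[v in LHS]hsubmxK mul_row_col mxE mul_mx_scalar mxE mulrC.
have emb_add h h' : emb (h + h') = emb h + emb h' by rewrite /emb add_row_mx addr0.
have emb_scale t h : emb (t *: h) = t *: emb h by rewrite /emb scale_row_mx scaler0.
have [Demb|] := pselect (forall h, D (emb h)).
  (* The cone contains the hyperplane: the sign of the first coordinate decides. *)
  have Dxe : ~ D (hd x *: e) by move=> Dxe; apply: Dx; rewrite [x]decomp; exact: DD.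
  exists (col_mx (- hd x)%:M 0 : 'cV_(1 + m)).
    apply/eqP => /(congr1 (@usubmx R 1 m 1)); rewrite col_mxKu linear0 => /matrixP/(_ 0 0).
    by rewrite !mxE /= => /eqP; rewrite oppr_eq0 => /eqP x0; apply: Dxe; rewrite x0 scale0r.
  move=> v Dv; rewrite top mulmx0 mxE addr0 mulrN oppr_ge0 leNgt; apply/negP => vx0.
  have v0 : hd v != 0 by apply: contraTneq vx0 => ->; rewrite mul0r ltxx.
  apply: Dxe.
  have -> : hd x *: e = (hd x / hd v) *: (v + emb (- tl v)).
    rewrite [v in v + _]decomp -addrA -emb_add subrr /emb row_mx0 addr0.
    by rewrite scalerA divfK.
  apply: DZ; last exact: DD.
  have -> : hd x / hd v = hd v * hd x / hd v ^+ 2 by field.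
  by rewrite divr_ge0 ?sqr_ge0 // ltW.
move=> /existsNP[h0 Dh0].
have [||||f' f'0 f'D] := IHm (fun h => D (emb h)).
- by rewrite /emb row_mx0.
- by move=> u v Du Dv; rewrite emb_add; exact: DD.
- by move=> t v t0 Dv; rewrite emb_scale; exact: DZ.
- by exists h0.
have scl (v : 'rV[R]_(1 + m)) : hd v != 0 -> D v ->
    D (Num.sg (hd v) *: e + emb (`|hd v|^-1 *: tl v)).
  move=> v0 Dv.
  have -> : Num.sg (hd v) = `|hd v|^-1 * hd v.
    by rewrite {3}[hd v]numEsg mulrCA mulVf ?mulr1 // normr_eq0.
  by rewrite emb_scale -scalerA -scalerDr -decomp; apply: DZ.
(* First the cases where the first coordinate has a constant sign on the cone. *)
have [P0|] := pselect (forall h, ~ D (e + emb h)).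
  exists (col_mx (- 1)%:M 0 : 'cV_(1 + m)).
    apply/eqP => /(congr1 (@usubmx R 1 m 1)); rewrite col_mxKu linear0 => /matrixP/(_ 0 0).
    by rewrite !mxE /= => /eqP; rewrite oppr_eq0 oner_eq0.
  move=> v Dv; rewrite top mulmx0 mxE addr0 mulrN1 oppr_ge0 leNgt; apply/negP => v0.
  by have := scl v (lt0r_neq0 v0) Dv; rewrite gtr0_sg // scale1r; apply: P0.
move=> /existsNP[hp /contrapT Php].
have [N0|] := pselect (forall h, ~ D (- e + emb h)).
  exists (col_mx 1%:M 0 : 'cV_(1 + m)).
    apply/eqP => /(congr1 (@usubmx R 1 m 1)); rewrite col_mxKu linear0 => /matrixP/(_ 0 0).
    by rewrite !mxE /= => /eqP; rewrite oner_eq0.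
  move=> v Dv; rewrite top mulmx0 mxE addr0 mulr1 leNgt; apply/negP => v0.
  by have := scl v (ltr0_neq0 v0) Dv; rewrite ltr0_sg // scaleN1r; apply: N0.
move=> /existsNP[hn /contrapT Nhn].
pose A : set R := [set - (h *m f') 0 0 | h in [set h | D (e + emb h)]]%classic.
have A0 : (A !=set0)%classic by exists (- (hp *m f') 0 0), hp.
have ubA h : D (- e + emb h) -> ubound A ((h *m f') 0 0).
  move=> Dh _ [h' Dh' <-]; rewrite -subr_ge0 opprK.
  have -> : (h *m f') 0 0 + (h' *m f') 0 0 = ((h + h') *m f') 0 0.
    by rewrite mulmxDl [RHS]mxE.
  apply: f'D; rewrite emb_add.
  have -> : emb h + emb h' = (- e + emb h) + (e + emb h').
    by rewrite addrACA addNr add0r.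
  exact: DD.
exists (col_mx (sup A)%:M f' : 'cV_(1 + m)).
  apply: contraNneq f'0 => /(congr1 (@dsubmx R 1 m 1)); rewrite col_mxKd => ->.
  by rewrite linear0.
move=> v Dv; rewrite top.
have [v0|v0|v0] := ltrgt0P (hd v).
- have := scl v (lt0r_neq0 v0) Dv; rewrite gtr0_sg // scale1r => Dh.
  have : - ((`|hd v|^-1 *: tl v) *m f') 0 0 <= sup A.
    by apply: ub_le_sup; [exists ((hn *m f') 0 0); exact: ubA|exists (`|hd v|^-1 *: tl v)].
  rewrite -scalemxAl mxE gtr0_norm // -mulrN mulrC ler_pdivrMr //.
  lra.
- have := scl v (ltr0_neq0 v0) Dv; rewrite ltr0_sg // scaleN1r => Dh.
  have : sup A <= ((`|hd v|^-1 *: tl v) *m f') 0 0.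
    by apply: ge_sup => //; exact: ubA.
  rewrite -scalemxAl mxE ltr0_norm // mulrC ler_pdivlMr ?oppr_gt0 //; lra.
- rewrite v0 mul0r add0r; apply: f'D.
  by move: Dv; rewrite [v in D v]decomp v0 scale0r add0r.
Qed.

(** Almost everywhere [g = |g|], so that the integral of [|g|] is at most 0. *)
Lemma conull_zero_set (d : measure_display) (T : measurableType d) (R : realType)
    (mu : {measure set T -> \bar R}) (S : set T) (g : T -> R) :
  measurable S -> mu (~` S)%classic = 0%E -> mu.-integrable setT (EFin \o g) ->
  (forall z, S z -> 0 <= g z) -> (\int[mu]_z (g z)%:E <= 0)%E ->
  let S' := (S `&` g @^-1` [set 0])%classic in
  measurable S' /\ mu (~` S')%classic = 0%E.
Proof.
move=> mS muS ig g_ge0 ig_le0 S'.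
have mg : measurable_fun setT g.
  by apply/measurable_EFinP; exact: measurable_int ig.
have mS' : measurable S'.
  by apply: measurableI => //; rewrite -[X in measurable X]setTI; exact: mg.
have Snull : mu.-negligible (~` S)%classic.
  by apply/negligibleP => //; exact: measurableC.
have absg : ae_eq mu setT (fun z => `|(g z)%:E|%E) (EFin \o g).
  apply: negligibleS Snull => z /= /not_implyP[_ nz] Sz; apply: nz.
  by rewrite ger0_norm // g_ge0.
have /(ae_eq_integral_abs mu measurableT (measurable_int _ ig)) g0 :
    (\int[mu]_z `|(EFin \o g) z| = 0)%E.
  apply/eqP; rewrite eq_le integral_ge0 // andbT.
  rewrite (ae_eq_integral (EFin \o g)) //; last exact: measurable_int ig.
  by apply: measurableT_comp => //; exact: measurable_int ig.
split=> //; apply: measure_negligible; first exact: measurableC.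
apply: negligibleS (negligibleU Snull g0) => z /= nS'.
have [Sz|] := pselect (S z); last by left.
right => /= h; apply: nS'; split=> //=.
by have [] := h I.
Qed.

(** Theorem of Richter and Tchakaloff.  If the vector [b] of the integrals is
    not in the cone generated by the vectors [v z] with [z] in [S], then a
    nonzero functional is nonnegative on this cone and nonpositive at [b].
    Integration shows that it vanishes at [v z] for almost every [z], so that one
    integrand is a combination of the others on a conull set, and the number of
    integrands drops. *)
Lemma integral_atomic (d : measure_display) (T : measurableType d) (R : realType)
    (mu : {measure set T -> \bar R}) (m : nat) (v : 'I_m -> T -> R) (S : set T) :
  measurable S -> mu (~` S)%classic = 0%E ->
  (forall i, mu.-integrable setT (EFin \o v i)) ->
  exists2 nu : seq (R * T), (forall a, a \in nu -> 0 <= a.1 /\ S a.2) &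
    forall i, (\int[mu]_z (v i z)%:E)%E = (\sum_(a <- nu) a.1 * v i a.2)%:E.
Proof.
elim: m v S => [|m IHm] v S mS muS iv; first by exists [::] => // -[].
pose good (nu : seq (R * T)) := forall a, a \in nu -> 0 <= a.1 /\ S a.2.
pose vec z : 'rV[R]_m.+1 := \row_i v i z.
pose comb (nu : seq (R * T)) : 'rV[R]_m.+1 := \sum_(a <- nu) a.1 *: vec a.2.
pose b : 'rV[R]_m.+1 := \row_i fine (\int[mu]_z (v i z)%:E)%E.
have bE i : (\int[mu]_z (v i z)%:E)%E = (b 0 i)%:E.
  by rewrite mxE fineK //; apply: integrable_fin_num (iv i).
have good_cat nu nu' : good nu -> good nu' -> good (nu ++ nu').
  by move=> gn gn' a; rewrite mem_cat => /orP[/gn|/gn'].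
have comb_cat nu nu' : comb (nu ++ nu') = comb nu + comb nu'.
  by rewrite /comb big_cat.
have scaleP t nu : 0 <= t -> good nu -> exists2 nu', good nu' & comb nu' = t *: comb nu.
  move=> t0 gn; exists [seq (t * a.1, a.2) | a <- nu].
    by move=> _ /mapP[a /gn[a0 Sa] ->]; split=> //; exact: mulr_ge0.
  by rewrite /comb big_map scaler_sumr; apply: eq_bigr => a _; rewrite scalerA.
have [[nu gn nub]|nb] := pselect (exists2 nu, good nu & comb nu = b).
  exists nu => // i; rewrite bE -nub /comb summxE; congr EFin.
  by apply: eq_bigr => a _; rewrite !mxE.
(* Adding [- b] to the cone makes the functional nonpositive at [b]. *)
pose D := [set x | exists nu t, [/\ good nu, 0 <= t & x = comb nu - t *: b]]%classic.
have [||||f f0 fD] := @convex_cone_halfspace R m.+1 D.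
- by exists [::], 0; split=> //; rewrite /comb big_nil scale0r subr0.
- move=> _ _ [nu [t [gn t0 ->]]] [nu' [t' [gn' t0' ->]]].
  exists (nu ++ nu'), (t + t'); split; [exact: good_cat|exact: addr_ge0|].
  by rewrite comb_cat scalerDl opprD addrACA.
- move=> r _ r0 [nu [t [gn t0 ->]]].
  have [nu' gn' nuE] := scaleP r nu r0 gn.
  exists nu', (r * t); split=> //; first exact: mulr_ge0.
  by rewrite nuE scalerBr scalerA.
- exists b => -[nu [t [gn t0 bE']]]; apply: nb.
  have t1 : 0 < 1 + t by rewrite ltr_pwDl.
  have [nu' gn' nuE] := scaleP (1 + t)^-1 nu (ltac:(by rewrite invr_ge0 ltW)) gn.
  exists nu' => //; rewrite nuE; apply: (scalerI (lt0r_neq0 t1)).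
  rewrite scalerA divff ?lt0r_neq0 // scale1r scalerDl scale1r.
  by rewrite {1}bE' subrK.
pose g z := \sum_i f i 0 * v i z.
have gE z : g z = (vec z *m f) 0 0.
  by rewrite mxE; apply: eq_bigr => i _; rewrite mxE mulrC.
have gEF z : (g z)%:E = (\sum_i (f i 0)%:E * (v i z)%:E)%E.
  by rewrite -sumEFin; apply: eq_bigr => i _.
have ifv i : mu.-integrable setT (fun z => (f i 0)%:E * (v i z)%:E)%E.
  exact: (integrableZl measurableT _ (iv i)).
have ig : mu.-integrable setT (EFin \o g).
  rewrite (_ : EFin \o g = fun z => (\sum_i (f i 0)%:E * (v i z)%:E)%E).
    exact: integrable_sum.
  by apply/funext => z; rewrite /= gEF.
have gint : (\int[mu]_z (g z)%:E)%E = ((b *m f) 0 0)%:E.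
  under eq_integral do rewrite gEF.
  rewrite integral_sum // mxE -sumEFin; apply: eq_bigr => i _.
  by rewrite integralZl //; [rewrite bE -EFinM mulrC|exact: iv].
have g_ge0 z : S z -> 0 <= g z.
  move=> Sz; rewrite gE; apply: fD; exists [:: (1, z)], 0; split=> //.
    by move=> a; rewrite inE => /eqP ->.
  by rewrite /comb big_seq1 scale1r scale0r subr0.
have bf_le0 : (b *m f) 0 0 <= 0.
  rewrite -oppr_ge0; have -> : - (b *m f) 0 0 = ((- b) *m f) 0 0 by rewrite mulNmx [RHS]mxE.
  by apply: fD; exists [::], 1; split=> //; rewrite /comb big_nil scale1r sub0r.
have [] := conull_zero_set mS muS ig g_ge0; first by rewrite gint lee_fin.
set S' := (S `&` _)%classic => mS' muS'.
have bf0 : (b *m f) 0 0 = 0.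
  apply: EFin_inj; rewrite -gint.
  rewrite (ae_eq_integral (cst 0%E)) ?integral0 //; first exact: measurable_int ig.
  exists (~` S')%classic; split=> //; first exact: measurableC.
  by move=> z /= /not_implyP[_ nz] [Sz gz]; apply: nz; rewrite gz.
(* The integrand [v k] is a combination of the others on [S']. *)
have /cV0Pn[k fk] := f0.
have [nu gn nuE] := IHm (fun i => v (lift k i)) S' mS' muS' (fun i => iv (lift k i)).
exists nu => [a /gn[a0 []] //|i].
have [j ->|->] := unliftP k i; first exact: nuE.
rewrite bE; congr EFin; apply: (mulfI fk).
have : \sum_i f i 0 * b 0 i = 0.
  by rewrite -[RHS]bf0 [RHS]mxE; apply: eq_bigr => j _; rewrite mulrC.
rewrite (bigD1_ord k) //= => /eqP; rewrite addr_eq0 => /eqP ->.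
have -> : \sum_(j < m) f (lift k j) 0 * b 0 (lift k j) =
    \sum_(a <- nu) a.1 * \sum_(j < m) f (lift k j) 0 * v (lift k j) a.2.
  under [RHS]eq_bigr do rewrite mulr_sumr.
  rewrite exchange_big /=. apply: eq_bigr => j _.
  have -> : b 0 (lift k j) = \sum_(a <- nu) a.1 * v (lift k j) a.2.
    by apply: EFin_inj; rewrite -bE nuE.
  by rewrite mulr_sumr; apply: eq_bigr => a _; rewrite mulrCA.
rewrite mulr_sumr -sumrN !big_seq; apply: eq_bigr => a /gn[_ [_ /= ga]].
have : \sum_j f j 0 * v j a.2 = 0 by exact: ga.
rewrite (bigD1_ord k) //= => /eqP; rewrite addr_eq0 => /eqP e.
by rewrite mulrCA e mulrN.
Qed.

(** * The truncated Hamburger moment problem *)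

(** The univariate Riesz functional of the sequence [s]. *)
Definition moment_form (R : nzRingType) (s : nat -> R) (q : {poly R}) : R :=
  \sum_(i < size q) q`_i * s i.

Lemma moment_form_widen (R : nzRingType) (s : nat -> R) (q : {poly R}) (m : nat) :
  (size q <= m)%N -> moment_form s q = \sum_(i < m) q`_i * s i.
Proof.
move=> qm; rewrite /moment_form (big_ord_widen_cond m xpredT (fun i => q`_i * s i)) //.
rewrite [RHS](bigID (fun i : 'I_m => (i < size q)%N)) /= [X in _ = _ + X]big1 ?addr0 //.
by move=> i; rewrite -leqNgt => /(nth_default 0) ->; rewrite mul0r.
Qed.

Lemma moment_form_is_linear (R : nzRingType) (s : nat -> R) :
  linear_for *%R (moment_form s).
Proof.
move=> a p q; set m := maxn (size p) (size q).
have pm : (size p <= m)%N by rewrite leq_maxl.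
have qm : (size q <= m)%N by rewrite leq_maxr.
have apm : (size (a *: p + q)%R <= m)%N.
  by rewrite (leq_trans (size_polyD _ _)) // geq_max qm (leq_trans (size_scale_leq _ _)).
rewrite !(moment_form_widen s (m := m)) // mulr_sumr -big_split /=.
by apply: eq_bigr => i _; rewrite coefD coefZ mulrDl mulrA.
Qed.

HB.instance Definition _ (R : nzRingType) (s : nat -> R) :=
  GRing.isLinear.Build R {poly R} R *%R (moment_form s) (moment_form_is_linear s).

Lemma moment_formXn (R : nzRingType) (s : nat -> R) (k : nat) :
  moment_form s 'X^k = s k.
Proof.
rewrite (moment_form_widen s (m := k.+1)) ?size_polyXn //.
rewrite big_ord_recr /= coefXn eqxx mul1r big1 ?add0r // => i _.
by rewrite coefXn ltn_eqF ?mul0r.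
Qed.


(** This replaces the discriminant in the Cauchy-Schwarz inequality for an
    isotropic vector. *)
Lemma affine_ge0_slope0 (R : realFieldType) (a b : R) :
  (forall t, 0 <= a + t * b) -> b = 0.
Proof.
move=> h; apply/eqP/negPn/negP => b0.
have := h (- (a + 1) / b); rewrite divfK // => ?; lra.
Qed.

(** An isotropic vector of a positive semidefinite form lies in its kernel. *)
Lemma moment_form_kernel (R : realFieldType) (s : nat -> R) (m : nat)
    (q g : {poly R}) :
  (forall f : {poly R}, (size f <= m)%N -> 0 <= moment_form s (f * f)) ->
  (size q <= m)%N -> (size g <= m)%N ->
  moment_form s (q * q) = 0 -> moment_form s (q * g) = 0.
Proof.
move=> pos qm gm qq0.
suff : 2 * moment_form s (q * g) = 0.
  by move/eqP; rewrite mulf_eq0 pnatr_eq0 /= => /eqP.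
apply: (@affine_ge0_slope0 _ (moment_form s (g * g))) => t.
have -> : moment_form s (g * g) + t * (2 * moment_form s (q * g)) =
    moment_form s ((g + t *: q) * (g + t *: q)).
  have -> : (g + t *: q) * (g + t *: q) =
      g * g + ((t * 2) *: (q * g) + (t * t) *: (q * q)).
    rewrite -!mul_polyC !rmorphM /= !polyCMn /=; ring.
  by rewrite !linearD !linearZ /= qq0 mulr0 addr0 mulrA.
apply: pos; rewrite (leq_trans (size_polyD _ _)) // geq_max gm.
by rewrite (leq_trans (size_scale_leq _ _)).
Qed.

Lemma moment_form_orthogonal (R : nzRingType) (s : nat -> R) (u g : {poly R}) (m : nat) :
  (size g <= m)%N ->
  (forall j, (j < m)%N -> moment_form s (u * 'X^j) = 0) ->
  moment_form s (g * u) = 0.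
Proof.
move=> gm orth; rewrite -[g]coefK poly_def mulr_suml linear_sum big1 // => i _ /=.
rewrite -scalerAl linearZ /= -commr_polyXn orth ?mulr0 //.
exact: leq_trans gm.
Qed.

Definition form_posdef (R : numDomainType) (s : nat -> R) (r : nat) : Prop :=
  forall f : {poly R}, f != 0 -> (size f <= r)%N -> 0 < moment_form s (f * f).

(** The Hankel matrix of a definite form is invertible, so [X^r] has an
    orthogonal projection on the polynomials of degree less than [r]. *)
Lemma orthogonal_polynomial (R : realFieldType) (s : nat -> R) (r : nat) :
  form_posdef s r ->
  exists q : {poly R}, [/\ q \is monic, size q = r.+1 &
    forall h : {poly R}, (size h <= r)%N -> moment_form s (q * h) = 0].
Proof.
move=> pos; pose H : 'M[R]_r := \matrix_(i, j) s (i + j)%N.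
have HE (v : 'rV[R]_r) (j : 'I_r) :
    (v *m H) 0 j = moment_form s (rVpoly v * 'X^j).
  rewrite mxE [rVpoly v]/rVpoly poly_def mulr_suml linear_sum; apply: eq_bigr => i _ /=.
  rewrite -scalerAl linearZ /= -exprD moment_formXn mxE insubT //= => ?.
  by congr (v _ _ * _); apply: val_inj.
have Hu : H \in unitmx.
  rewrite -row_free_unit; apply: inj_row_free => v vH0.
  apply: (can_inj rVpolyK); rewrite linear0; apply/eqP/negPn/negP => v0.
  have := pos _ v0 (size_poly _ _).
  rewrite (moment_form_orthogonal (size_poly _ _)) ?ltxx // => j jr.
  by rewrite -(HE v (Ordinal jr)) vH0 mxE.
pose u : 'rV[R]_r := \row_j s (r + j)%N; pose v := u *m invmx H.
have szv : (size (- rVpoly v)%R < size ('X^r : {poly R}))%N.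
  by rewrite size_polyN size_polyXn ltnS size_poly.
exists ('X^r - rVpoly v); split.
- by rewrite monicE lead_coefDl // lead_coefXn.
- by rewrite size_polyDl // size_polyXn.
- move=> h hr; rewrite mulrC; apply: moment_form_orthogonal hr _ => j jr.
  rewrite mulrBl linearB /= -(HE v (Ordinal jr)) mulmxKV // mxE.
  by rewrite -exprD moment_formXn subrr.
Qed.

(** In the singular case an isotropic polynomial of least degree plays the role
    of the orthogonal polynomial.  It is even orthogonal to more than the domain
    of the form: if [f] is in the kernel then so is [X f], because
    [L ((X f)^2) = L (f (X^2 f))], as long as the degrees permit. *)
Lemma null_polynomial (R : realFieldType) (s : nat -> R) (K r : nat) :
  (forall f : {poly R}, (size f <= K.+1)%N -> 0 <= moment_form s (f * f)) ->
  form_posdef s r -> ~ form_posdef s r.+1 -> (r < K)%N ->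
  exists q : {poly R}, [/\ q \is monic, size q = r.+1 &
    forall h : {poly R}, (size h <= 2 * K - r)%N -> moment_form s (q * h) = 0].
Proof.
move=> pos pd npd rK.
have [f [f0 fr ff0]] : exists f : {poly R},
    [/\ f != 0, size f = r.+1 & moment_form s (f * f) = 0].
  apply: contrapT => nex; apply: npd => f f0 fr.
  have f_ge0 : 0 <= moment_form s (f * f) by apply: pos; apply: leq_trans fr _; lia.
  rewrite lt_neqAle f_ge0 andbT eq_sym; apply/negP => /eqP ff0.
  apply: nex; exists f; split=> //; apply/eqP; rewrite eqn_leq fr /= ltnNge.
  by apply/negP => fr'; have := pd _ f0 fr'; rewrite ff0 ltxx.
have ker i : (r + i < K)%N -> forall g : {poly R}, (size g <= K.+1)%N ->
    moment_form s ((f * 'X^i) * g) = 0.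
  elim: i => [|i IHi] riK g gK.
    rewrite expr0 mulr1; by apply: (moment_form_kernel pos) => //; rewrite fr; lia.
  have szi k : size (f * 'X^k) = (r + k).+1.
    by rewrite size_mulXn // fr addnS addnC.
  apply: (moment_form_kernel pos) => //; first by rewrite szi; lia.
  have -> : f * 'X^(i.+1) * (f * 'X^(i.+1)) = f * 'X^i * (f * 'X^(i.+2)).
    by rewrite !exprS; ring.
  by apply: IHi; rewrite ?szi; lia.
exists ((lead_coef f)^-1 *: f); split.
- by rewrite monicE lead_coefZ mulVf // lead_coef_eq0.
- by rewrite size_scale // invr_eq0 lead_coef_eq0.
- move=> h hK; rewrite -scalerAl linearZ /= mulrC [f * h]mulrC.
  rewrite (moment_form_orthogonal hK) ?mul0r // => j jK.
  (* [X^(j - K)] goes to the kernel element, so that the test polynomial has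
     degree at most [K]. *)
  have -> : f * 'X^j = f * 'X^(j - K) * 'X^(minn j K).
    by rewrite -mulrA -exprD; congr (_ * 'X^ _); lia.
  have [jleK|Kltj] := leqP j K.
    by apply: ker; rewrite ?size_polyXn; lia.
  by apply: ker; rewrite ?size_polyXn; lia.
Qed.

(** A polynomial without a factor [(X - a)^2 + b^2] is, up to a constant, a
    product of distinct linear factors: a complex root [a + b i] with [b != 0]
    yields such a factor, and a double real root yields one with [b = 0]. *)
Lemma simple_real_roots_or_square_factor (R : rcfType) (q : {poly R}) :
  q != 0 ->
  (exists2 rs : seq R, uniq rs & q = lead_coef q *: \prod_(z <- rs) ('X - z%:P)) \/
  (exists a b : R, exists q1 : {poly R}, q = (('X - a%:P) ^+ 2 + (b ^+ 2)%:P) * q1).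
Proof.
elim: {q}(size q) {-2}q (erefl (size q)) => [|m IHm] q sq q0.
  by move/eqP: sq q0; rewrite size_poly_eq0 => ->.
have [/size1_polyC qC|q1] := leqP (size q) 1.
  left; exists [::] => //; rewrite big_nil qC lead_coefC.
  by rewrite -mul_polyC mulr1.
pose toC := real_complex_def (Phant R).
have [w qw] : exists w : complex R, root (map_poly toC q) w.
  by apply/closed_rootP; rewrite size_map_poly gtn_eqF.
case: w qw => a b qw.
have [b0|b0] := eqVneq b 0.
  have /factor_theorem[q' qE] : root q a.
    by rewrite -(fmorph_root toC) /toC; rewrite b0 in qw.
  have q'0 : q' != 0 by apply: contraNneq q0 => q'0; rewrite qE q'0 mul0r.
  have sq' : size q' = m.
    by apply/eqP; rewrite -eqSS -sq qE size_Mmonic ?monicXsubC // size_XsubC addn2.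
  have [[rs urs q'E]|[c [d [q2 q'E]]]] := IHm q' sq' q'0; last first.
    by right; exists c, d, (q2 * ('X - a%:P)); rewrite qE q'E mulrA.
  have [ars|ars] := boolP (a \in rs).
    right; exists a, 0, (lead_coef q' *: \prod_(z <- rem a rs) ('X - z%:P)).
    rewrite qE {1}q'E (perm_big _ (perm_to_rem ars)) big_cons /= -!mul_polyC.
    by rewrite expr0n /= polyC0; ring.
  left; exists (a :: rs); first by rewrite /= ars.
  have -> : lead_coef q = lead_coef q' by rewrite qE lead_coefM lead_coefXsubC mulr1.
  by rewrite qE {1}q'E big_cons mulrC scalerAr.
right; exists a, b; set d := _ + _.
have md : d \is monic.
  rewrite monicE lead_coefDl ?lead_coef_exp ?lead_coefXsubC ?expr1n //.
  by rewrite size_exp_XsubC (leq_ltn_trans (size_polyC_leq1 _)).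
have sd : size d = 3%N.
  rewrite size_polyDl ?size_exp_XsubC //.
  by rewrite (leq_ltn_trans (size_polyC_leq1 _)).
have dw : root (map_poly toC d) (Complex a b).
  rewrite rmorphD rmorphXn rmorphB /= map_polyX !map_polyC rootE !hornerE /toC.
  apply/eqP; rewrite /real_complex_def expr2; congr Complex => /=; ring.
have q_eq := divp_eq q d.
have rw : root (map_poly toC (q %% d)) (Complex a b).
  have := qw; rewrite {1}q_eq rootE rmorphD rmorphM /= !hornerE /=.
  by rewrite (eqP dw) mulr0 add0r.
have r0 : q %% d = 0.
  have sr : (size (q %% d)%R <= 2)%N.
    by rewrite -ltnS -sd ltn_modp monic_neq0.
  have rE : q %% d = (q %% d)`_1 *: 'X + ((q %% d)`_0)%:P.
    apply/polyP => -[|[|i]]; rewrite coefD coefZ coefX coefC /= ?mulr0 ?mulr1 ?addr0 ?add0r //.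
    by rewrite nth_default // (leq_trans sr).
  move: rw; rewrite rE rmorphD /= map_polyZ map_polyX map_polyC rootE !hornerE /=.
  rewrite complex.eq_complex /= !(mul0r, add0r, addr0, subr0, oppr0) mulf_eq0 (negPf b0) orbF.
  by case/andP => + /eqP r1; rewrite r1 mul0r add0r => /eqP ->; rewrite scale0r polyC0 addr0.
by exists (q %/ d); rewrite {1}q_eq r0 addr0 mulrC.
Qed.

(** If [q] had a factor [(X - a)^2 + b^2], with cofactor [q1], then [q] would be
    orthogonal to [q1] although [q q1 = ((X - a) q1)^2 + b^2 q1^2], where the
    form is definite at [(X - a) q1] and [q1]. *)
Lemma orthogonal_simple_roots (R : rcfType) (s : nat -> R) (r : nat) (q : {poly R}) :
  form_posdef s r -> q \is monic -> size q = r.+1 ->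
  (forall h : {poly R}, (size h <= r)%N -> moment_form s (q * h) = 0) ->
  exists2 rs : seq R, uniq rs & q = \prod_(z <- rs) ('X - z%:P).
Proof.
move=> pd mq sq orth; have q0 := monic_neq0 mq.
have [[rs urs qE]|[a [b [q1 qE]]]] := simple_real_roots_or_square_factor q0.
  by exists rs => //; rewrite {1}qE (monicP mq) scale1r.
have q10 : q1 != 0 by apply: contraNneq q0 => q10; rewrite qE q10 mulr0.
have sz1 : size (('X - a%:P) * q1) = (size q1).+1.
  by rewrite size_monicM ?monicXsubC // size_XsubC.
have sz : r.+1 = (size q1).+2.
  rewrite -sq qE; set d := _ + _.
  have ltd : (size ((b ^+ 2)%:P : {poly R}) < size (('X - a%:P) ^+ 2))%N.
    by rewrite size_exp_XsubC (leq_ltn_trans (size_polyC_leq1 _)).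
  have sd : size d = 3%N by rewrite size_polyDl // size_exp_XsubC.
  have md : d \is monic.
    by rewrite monicE lead_coefDl // lead_coef_exp lead_coefXsubC expr1n.
  by rewrite size_monicM // sd addSn.
have q1_gt0 : 0 < moment_form s (('X - a%:P) * q1 * (('X - a%:P) * q1)).
  apply: pd; last by rewrite sz1 -ltnS sz.
  by rewrite mulf_neq0 // polyXsubC_eq0.
have q1r : (size q1 <= r)%N by rewrite -ltnS sz.
have q1_ge0 : 0 < moment_form s (q1 * q1) by exact: pd.
have := orth q1 q1r; rewrite qE.
have -> : (('X - a%:P) ^+ 2 + (b ^+ 2)%:P) * q1 * q1 =
    ('X - a%:P) * q1 * (('X - a%:P) * q1) + b ^+ 2 *: (q1 * q1).
  by rewrite -mul_polyC; ring.
rewrite linearD linearZ /= => /eqP; rewrite gt_eqF //.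
by rewrite ltr_wpDr // mulr_ge0 ?sqr_ge0 // ltW.
Qed.

(** The nodes are the roots of [q] and the weights are the values of the form at
    the Lagrange polynomials [lag].  A weight is nonnegative because
    [lag^2 - lag] is a multiple of [q], which the form annihilates. *)
Lemma gauss_quadrature (R : rcfType) (s : nat -> R) (K r : nat) (q : {poly R}) :
  (r <= K)%N -> form_posdef s r -> q \is monic -> size q = r.+1 ->
  (forall h : {poly R}, (size h <= 2 * K - r)%N -> moment_form s (q * h) = 0) ->
  exists2 nu : seq (R * R), (forall a, a \in nu -> 0 <= a.1) &
    forall k, (k < 2 * K)%N -> s k = \sum_(a <- nu) a.1 * a.2 ^+ k.
Proof.
move=> rK pd mq sq orth; have q0 := monic_neq0 mq.
have [rs urs qE] : exists2 rs : seq R, uniq rs & q = \prod_(z <- rs) ('X - z%:P).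
  by apply: orthogonal_simple_roots pd mq sq _ => h hr; apply: orth; lia.
have srs : size rs = r.
  by apply/eqP; rewrite -eqSS -sq qE size_prod_XsubC.
have vanish (f : {poly R}) : (size f <= 2 * K)%N ->
    (forall z, z \in rs -> f.[z] = 0) -> moment_form s f = 0.
  move=> fK fz; have qf : q %| f.
    rewrite qE uniq_roots_dvdp ?uniq_rootsE //.
    by apply/allP => z zrs; rewrite rootE fz.
  rewrite -(divpK qf) mulrC; apply: orth.
  by rewrite size_divp // sq leq_sub2r.
pose num z : {poly R} := \prod_(w <- rem z rs) ('X - w%:P).
pose lag z := (num z).[z]^-1 *: num z.
have num_z z : z \in rs -> (num z).[z] != 0.
  move=> zrs; rewrite -rootE root_prod_XsubC mem_rem_uniqF //.
have lagE z w : z \in rs -> w \in rs -> (lag z).[w] = (z == w)%:R.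
  move=> zrs wrs; rewrite hornerZ; have [<-|zw] := eqVneq z w.
    by rewrite mulVf // num_z.
  apply/eqP; rewrite mulf_eq0 -[X in _ || X]rootE root_prod_XsubC.
  by rewrite mem_rem_uniq // !inE [w == z]eq_sym zw wrs orbT.
have slag z : z \in rs -> (size (lag z) <= r)%N.
  move=> zrs; rewrite (leq_trans (size_scale_leq _ _)) // size_prod_XsubC.
  by rewrite size_rem // prednK ?srs // -srs; case: (rs) zrs.
exists [seq (moment_form s (lag z), z) | z <- rs].
  move=> _ /mapP[z zrs ->] /=.
  suff -> : moment_form s (lag z) = moment_form s (lag z * lag z).
    have [->|lag0] := eqVneq (lag z) 0; first by rewrite mul0r linear0.
    exact/ltW/pd/slag.
  apply/eqP; rewrite eq_sym -subr_eq0 -linearB /=; apply/eqP/vanish.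
    rewrite (leq_trans (size_polyD _ _)) // geq_max size_polyN.
    have lagK := leq_trans (slag z zrs) rK.
    rewrite mul2n -addnn (leq_trans lagK) ?leq_addr // andbT.
    by rewrite (leq_trans (size_polyMleq _ _)) // (leq_trans (leq_pred _)) // leq_add.
  move=> w wrs; rewrite hornerD hornerN hornerM lagE //; case: (z == w); rewrite /=; ring.
move=> k kK; rewrite big_map /= -(moment_formXn s).
apply/eqP; rewrite -subr_eq0; apply/eqP.
transitivity (moment_form s ('X^k - \sum_(z <- rs) z ^+ k *: lag z)).
  rewrite linearB /= linear_sum; congr (_ - _); apply: eq_bigr => z _ /=.
  by rewrite [RHS]linearZ /= mulrC.
apply: vanish.
  rewrite (leq_trans (size_polyD _ _)) // geq_max size_polyXn kK size_polyN.
  rewrite big_seq (leq_trans (size_sum _ _ _)) //; apply/bigmax_leqP_seq => z zrs _.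
  by rewrite (leq_trans (size_scale_leq _ _)) // (leq_trans (slag z zrs)) //; lia.
move=> w wrs; rewrite hornerD hornerN hornerXn horner_sum (bigD1_seq w) //=.
rewrite hornerZ lagE // eqxx mulr1 big_seq_cond big1 ?addr0 ?subrr //.
by move=> z /andP[zrs zw]; rewrite hornerZ lagE // (negPf zw) mulr0.
Qed.

(** The degree [r] of the node polynomial is the least degree of an isotropic
    polynomial, or [K] if the form is definite below degree [K].  The moment of
    order [2 K] is excluded: it may exceed that of every representing measure,
    as when only [s (2 K)] is nonzero. *)
Lemma truncated_hamburger (R : rcfType) (s : nat -> R) (K : nat) :
  (forall f : {poly R}, (size f <= K.+1)%N -> 0 <= moment_form s (f * f)) ->
  exists2 nu : seq (R * R), (forall a, a \in nu -> 0 <= a.1) &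
    forall k, (k < 2 * K)%N -> s k = \sum_(a <- nu) a.1 * a.2 ^+ k.
Proof.
move=> pos.
have [r rK [pd npd]] : exists2 r, (r <= K)%N &
    form_posdef s r /\ (r = K \/ ~ form_posdef s r.+1).
  elim: K {pos} => [|K [r rK [pd npd]]].
    by exists 0%N => //; split; [move=> f + /size_poly_leq0P => /[swap] -> /eqP|left].
  case: npd => [rE|npd]; last by exists r; [lia|split; [|right]].
  have [pd'|npd'] := pselect (form_posdef s K.+1); first by exists K.+1; [|split; [|left]].
  by exists r => //; [lia|split => //; right; rewrite rE].
case: npd => [rE|npd].
  have [q [mq sq orth]] := orthogonal_polynomial pd.
  apply: (gauss_quadrature rK pd mq sq) => h hr; apply: orth.
  by move: hr; rewrite rE mul2n -addnn addnK.
have [rE|neK] := eqVneq r K.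
  have [q [mq sq orth]] := orthogonal_polynomial pd.
  apply: (gauss_quadrature rK pd mq sq) => h hr; apply: orth.
  by move: hr; rewrite rE mul2n -addnn addnK.
have ltrK : (r < K)%N by rewrite ltn_neqAle neK.
have [q [mq sq orth]] := null_polynomial pos pd npd ltrK.
exact: gauss_quadrature rK pd mq sq orth.
Qed.

(** * Moments on the axes and on the curve *)

(** Positivity of the moment matrix of order [M], stated for arbitrary finite
    families of monomials; repetitions make substitutions of monomials easy. *)
Definition psd_upto (R : numDomainType) (M : nat) (g : nat -> nat -> R) : Prop :=
  forall (I : finType) (c : I -> R) (i j : I -> nat),
    (forall a, i a + j a <= M)%N ->
    0 <= \sum_a \sum_b c a * c b * g (i a + i b)%N (j a + j b)%N.

(** An atom is a weight paired with a point of the plane. *)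
Definition atomic_upto (R : numDomainType) (Z : R -> R -> Prop) (m : nat)
    (g : nat -> nat -> R) : Prop :=
  exists2 nu : seq (R * (R * R)), (forall a, a \in nu -> 0 <= a.1 /\ Z a.2.1 a.2.2) &
    forall i j, (i + j <= m)%N ->
      g i j = \sum_(a <- nu) a.1 * (a.2.1 ^+ i * a.2.2 ^+ j).

Lemma atomic_uptoD (R : numDomainType) (Z1 Z2 Z : R -> R -> Prop) (m : nat)
    (g1 g2 g : nat -> nat -> R) :
  (forall x y, Z1 x y -> Z x y) -> (forall x y, Z2 x y -> Z x y) ->
  (forall i j, (i + j <= m)%N -> g i j = g1 i j + g2 i j) ->
  atomic_upto Z1 m g1 -> atomic_upto Z2 m g2 -> atomic_upto Z m g.
Proof.
move=> Z1Z Z2Z gE [nu1 nu1P g1E] [nu2 nu2P g2E]; exists (nu1 ++ nu2).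
  by move=> a; rewrite mem_cat => /orP[/nu1P[? /Z1Z]|/nu2P[? /Z2Z]].
by move=> i j ijm; rewrite gE // g1E // g2E // big_cat.
Qed.

Lemma moment_formM (R : comNzRingType) (s : nat -> R) (p q : {poly R}) (m : nat) :
  (size p <= m)%N -> (size q <= m)%N ->
  moment_form s (p * q) = \sum_(i < m) \sum_(j < m) p`_i * q`_j * s (i + j)%N.
Proof.
have widen (f : {poly R}) : (size f <= m)%N -> f = \sum_(i < m) f`_i *: 'X^i.
  move=> fm; rewrite -poly_def; apply/polyP => i; rewrite coef_poly.
  by case: ltnP => // mi; rewrite nth_default // (leq_trans fm).
move=> pm qm; rewrite {1}(widen p pm) {1}(widen q qm) mulr_suml linear_sum /=.
apply: eq_bigr => i _; rewrite mulr_sumr linear_sum /=; apply: eq_bigr => j _.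
by rewrite -scalerAl -scalerAr scalerA linearZ /= -exprD moment_formXn.
Qed.

Lemma coprime_exponent (a b e : nat) : (0 < a)%N -> (0 < b)%N -> coprime a b ->
  exists i j, (j < b)%N /\ (i * b = e + j * a)%N.
Proof.
move=> a0 b0 ab; pose t := chinese a b 0 (e * b.-1).
have /dvdnP[j0 tE] : (a %| t)%N by rewrite /dvdn (chinese_modl ab) mod0n.
have bt : (b %| e + t)%N.
  rewrite /dvdn -modnDmr (chinese_modr ab) modnDmr -mulnS prednK //.
  by rewrite modnMl.
have /dvdnP[i iE] : (b %| e + (j0 %% b) * a)%N.
  by rewrite /dvdn -modnDmr modnMml modnDmr -tE.
by exists i, (j0 %% b)%N; rewrite ltn_pmod.
Qed.

(** The exponent [k - (n l1 + 1)] of the parameter is written [i l2 - j l1] with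
    either [j < l2] or [i < l1], according to its sign; then [i + j] is bounded
    by [n + l1 + l2 - 2]. *)
Lemma exponent_representative (l1 l2 n k : nat) :
  (1 < l1)%N -> (1 < l2)%N -> coprime l1 l2 -> (k <= n * (l1 + l2) + 2)%N ->
  exists i j, (i + j + 2 <= n + l1 + l2)%N /\ (i * l2 + (n * l1 + 1) = k + j * l1)%N.
Proof.
move=> h1 h2 co kK; have [Ak|/ltnW kA] := leqP (n * l1 + 1) k.
  have [i [j [jl iE]]] :=
    @coprime_exponent l1 l2 (k - (n * l1 + 1)) (ltnW h1) (ltnW h2) co.
  exists i, j; split; last lia.
  have : (i * l2 < (n + l1) * l2)%N by nia.
  by rewrite ltn_mul2r => /andP[_]; lia.
rewrite coprime_sym in co.
have [j [i [il jE]]] :=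
  @coprime_exponent l2 l1 (n * l1 + 1 - k) (ltnW h2) (ltnW h1) co.
exists i, j; split; last lia.
have : (j * l1 < (n + l2) * l1)%N by nia.
by rewrite ltn_mul2r => /andP[_]; lia.
Qed.

(** Two monomials with the same restriction to the curve differ by a power of
    [x^l1 y^l2], as [l1] and [l2] are coprime. *)
Lemma periodic_moments (R : Type) (l1 l2 B : nat) (g : nat -> nat -> R) :
  (0 < l1)%N -> (0 < l2)%N -> coprime l1 l2 ->
  (forall i j, (i + j + (l1 + l2) <= B)%N -> g (i + l1)%N (j + l2)%N = g i j) ->
  forall i j i' j', (i + j <= B)%N -> (i' + j' <= B)%N ->
    (i * l2 + j' * l1 = i' * l2 + j * l1)%N -> g i j = g i' j'.
Proof.
move=> h1 h2 co per i j i' j'.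
wlog ii' : i j i' j' / (i <= i')%N => [wl ijB ijB' e|ijB ijB' e].
  have [ii'|/ltnW ii'] := leqP i i'; first exact: wl.
  by apply/esym/wl.
have jj' : (j <= j')%N by rewrite -(leq_pmul2r h1); nia.
have e' : ((i' - i) * l2 = (j' - j) * l1)%N by rewrite !mulnBl; lia.
have /dvdnP[q qE] : (l1 %| i' - i)%N.
  by rewrite -(Gauss_dvdl _ co) e' dvdn_mull.
have q'E : (j' - j = q * l2)%N.
  by apply/eqP; rewrite -(eqn_pmul2r h1) -e' qE mulnAC.
have {qE q'E} [iE jE] : (i' = i + q * l1)%N /\ (j' = j + q * l2)%N by lia.
rewrite {}iE {}jE {e ii' jj' e'} in ijB' *.
elim: q ijB' => [|q IHq] qB; first by rewrite !mul0n !addn0.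
have qB' : (i + q * l1 + (j + q * l2) + (l1 + l2) <= B)%N.
  by apply: leq_trans qB; rewrite !mulSn; lia.
rewrite !mulSn ![(_ + q * _)%N]addnC !addnA per //.
by apply: IHq; apply: leq_trans qB'; rewrite leq_addr.
Qed.

(** Along [x = t^l2], [y = t^-l1] the moments become the values of a functional
    on Laurent polynomials in [t].  It is positive on squares of combinations of
    [t^(k - n l1 - 1)] for [k <= n (l1 + l2) + 2]; shifting the exponents gives a Hankel form,
    and its representing measure is divided by [t^(2 (n l1 + 1))].  An atom at 0
    contributes to [s 0] only, which is not among the moments in question, so
    that it can be dropped. *)
Lemma curve_moments_atomic (R : rcfType) (l1 l2 n : nat) (g : nat -> nat -> R) :
  (1 < l1)%N -> (1 < l2)%N -> coprime l1 l2 ->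
  psd_upto (n + l1 + l2 - 2) g ->
  (forall i j, (i + j + (l1 + l2) <= 2 * (n + l1 + l2 - 2))%N ->
    g (i + l1)%N (j + l2)%N = g i j) ->
  atomic_upto (fun x y => x ^+ l1 * y ^+ l2 = 1) (2 * n) g.
Proof.
move=> h1 h2 co pos per; set M := (n + l1 + l2 - 2)%N in pos per.
pose K := (n * (l1 + l2) + 2)%N.
have inv := periodic_moments (ltnW h1) (ltnW h2) co per.
have [f fP] : exists f : nat -> nat * nat, forall k, (k <= K)%N ->
    ((f k).1 + (f k).2 <= M)%N /\ ((f k).1 * l2 + (n * l1 + 1) = k + (f k).2 * l1)%N.
  suff /choice[f fP] : forall k, exists ij : nat * nat, (k <= K)%N ->
      (ij.1 + ij.2 <= M)%N /\ (ij.1 * l2 + (n * l1 + 1) = k + ij.2 * l1)%N.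
    by exists f.
  move=> k; have [kK|_] := leqP k K; last by exists (0, 0)%N.
  have [i [j [ijM ijE]]] := exponent_representative h1 h2 co kK.
  by exists (i, j) => _; split=> //=; rewrite /M; lia.
(* Any splitting of [k] into two exponents at most [K] would do. *)
pose s k := g ((f (minn k K)).1 + (f (k - minn k K)%N).1)%N
              ((f (minn k K)).2 + (f (k - minn k K)%N).2)%N.
have sE k i j : (k <= 2 * K)%N -> (i + j <= 2 * M)%N ->
    (i * l2 + 2 * (n * l1 + 1) = k + j * l1)%N -> s k = g i j.
  move=> kK ijM ijE.
  have [m1 e1] := fP (minn k K) (geq_minr k K).
  have k2K : (k - minn k K <= K)%N by lia.
  have [m2 e2] := fP _ k2K.
  by apply: inv; lia.
have [f0 f0K|nu nuP sN] := @truncated_hamburger R s K.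
  rewrite (moment_formM s f0K f0K).
  have -> : \sum_(i < K.+1) \sum_(j < K.+1) f0`_i * f0`_j * s (i + j)%N =
      \sum_(i < K.+1) \sum_(j < K.+1) f0`_i * f0`_j *
        g ((f i).1 + (f j).1)%N ((f i).2 + (f j).2)%N.
    apply: eq_bigr => i _; apply: eq_bigr => j _; congr (_ * _).
    have [mi ei] := fP i (leq_ord i); have [mj ej] := fP j (leq_ord j).
    by apply: sE; have := leq_ord i; have := leq_ord j; lia.
  apply: (pos _ (fun i : 'I_K.+1 => f0`_i) (fun i => (f i).1) (fun i => (f i).2)) => i.
  by case: (fP i (leq_ord i)).
exists [seq (a.1 * a.2 ^+ (2 * (n * l1 + 1)), (a.2 ^+ l2, a.2 ^- l1)) |
         a <- nu & a.2 != 0].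
  move=> _ /mapP[a + ->]; rewrite mem_filter => /andP[a0 /nuP a_ge0] /=; split.
    by rewrite mulr_ge0 // exprM exprn_ge0 // sqr_ge0.
  by rewrite exprVn -!exprM mulnC divff // expf_neq0.
move=> i j ijn.
have jl : (j * l1 <= 2 * n * l1)%N by rewrite leq_mul2r; lia.
have il : (i * l2 <= 2 * n * l2)%N by rewrite leq_mul2r; lia.
pose k := (i * l2 + 2 * (n * l1 + 1) - j * l1)%N.
have kE : (i * l2 + 2 * (n * l1 + 1) = k + j * l1)%N by rewrite /k; lia.
have kK : (k < 2 * K)%N by rewrite /k /K; lia.
rewrite -(sE k) ?(ltnW kK) //; last by rewrite /M; lia.
rewrite sN // big_map big_filter [LHS](bigID (fun a => a.2 != 0)) /=.
rewrite [X in _ + X]big1 ?addr0; last first.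
  move=> a /negPn/eqP ->; rewrite expr0n (_ : k == 0%N = false) ?mulr0 //.
  by apply/negbTE; lia.
apply: eq_bigr => a a0; rewrite -mulrA; congr (_ * _).
rewrite exprVn -!exprM mulrA -exprD addnC [(l2 * i)%N]mulnC kE exprD.
by rewrite [(j * l1)%N]mulnC mulfK // expf_neq0.
Qed.

Lemma moment_form_lower (R : nzRingType) (s : nat -> R) (k : R) (q : {poly R}) :
  moment_form (fun i => s i - (i == 0)%:R * k) q = moment_form s q - q`_0 * k.
Proof.
rewrite !(moment_form_widen _ (leqnSn (size q))) !big_ord_recl /=.
rewrite mul1r mulrBr addrAC; congr (_ + _ - _); apply: eq_bigr => i _.
by rewrite mul0r subr0.
Qed.

(** The form is evaluated at [F(x) + G(y) - G(0)], whose restrictions to the axes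
    are [F] and [G]. *)
Lemma axes_form_ge0 (R : realFieldType) (M : nat) (g : nat -> nat -> R)
    (F G : {poly R}) :
  psd_upto M g -> (forall i j, (i.+1 + j.+1 <= 2 * M)%N -> g i.+1 j.+1 = 0) ->
  (size F <= M.+1)%N -> (size G <= M.+1)%N -> F`_0 = G`_0 ->
  F`_0 ^+ 2 * g 0%N 0%N <=
    moment_form (g ^~ 0%N) (F * F) + moment_form (g 0%N) (G * G).
Proof.
move=> pos g0 FM GM FG0.
pose G' := G - (G`_0)%:P.
have G'M : (size G' <= M.+1)%N.
  rewrite (leq_trans (size_polyD _ _)) // geq_max GM size_polyN.
  by rewrite (leq_trans (size_polyC_leq1 _)).
have G'0 : G'`_0 = 0 by rewrite coefB coefC subrr.
have cross : \sum_(i < M.+1) \sum_(j < M.+1) F`_i * G'`_j * g i j =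
    F`_0 * moment_form (g 0%N) G'.
  rewrite big_ord_recl /= [X in _ + X]big1 ?addr0.
    rewrite (moment_form_widen _ G'M) mulr_sumr.
    by apply: eq_bigr => j _; rewrite mulrA.
  move=> i _; rewrite big1 // => -[[|j] jM] _ /=; first by rewrite G'0 mulr0 mul0r.
  by rewrite g0 ?mulr0 //; have := ltn_ord i; lia.
(* The constant monomial of the second family has coefficient [G'`_0 = 0]. *)
have posFG := pos ('I_M.+1 + 'I_M.+1)%type
  (fun a => match a with inl i => F`_i | inr j => G'`_j end)
  (fun a => match a with inl i => val i | inr _ => 0%N end)
  (fun a => match a with inl _ => 0%N | inr j => val j end).
have {posFG} := posFG (ltac:(by case=> k; rewrite /= ?addn0 ?add0n leq_ord)).
rewrite big_sumType /=.
set S1 := \sum_(i < M.+1) _; set S2 := \sum_(i < M.+1) _.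
have -> : S1 = moment_form (g ^~ 0%N) (F * F) + F`_0 * moment_form (g 0%N) G'.
  rewrite -cross (moment_formM _ FM FM) -big_split; apply: eq_bigr => i _ /=.
  rewrite big_sumType /=; congr (_ + _); apply: eq_bigr => j _.
  by rewrite addn0 add0n.
have -> : S2 = F`_0 * moment_form (g 0%N) G' + moment_form (g 0%N) (G' * G').
  rewrite -cross exchange_big (moment_formM _ G'M G'M) -big_split.
  apply: eq_bigr => j _ /=; rewrite big_sumType /=; congr (_ + _).
  by apply: eq_bigr => i _; rewrite addn0 add0n [F`_i * _]mulrC.
have lin1 : moment_form (g 0%N) G' = moment_form (g 0%N) G - G`_0 * g 0%N 0%N.
  by rewrite linearB /= -[_%:P]mulr1 mul_polyC linearZ /= -(expr0 'X) moment_formXn.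
have -> : moment_form (g 0%N) (G' * G') = moment_form (g 0%N) (G * G) -
    2 * G`_0 * moment_form (g 0%N) G + G`_0 ^+ 2 * g 0%N 0%N.
  have -> : G' * G' = G * G - (2 * G`_0) *: G + (G`_0 ^+ 2) *: 'X^0.
    by rewrite -!mul_polyC !polyCM polyCMn expr0 /G'; ring.
  by rewrite linearD linearB !linearZ /= moment_formXn.
rewrite lin1 FG0; lra.
Qed.

(** The value [c] of the functional at 1 is divided between the axes: [kappa] is
    the greatest number whose removal from the [x]-axis keeps that form positive,
    and [axes_form_ge0] says that the [y]-axis then only needs [kappa] of the
    total [c].  The moments of order 0 thus become [c - kappa] and [kappa]. *)
Lemma axes_moments_atomic (R : realType) (M n : nat) (g : nat -> nat -> R) :
  (n < M)%N -> psd_upto M g ->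
  (forall i j, (i.+1 + j.+1 <= 2 * M)%N -> g i.+1 j.+1 = 0) ->
  atomic_upto (fun x y => x * y = 0) (2 * n) g.
Proof.
move=> nM pos g0; pose c := g 0%N 0%N.
pose La := moment_form (g ^~ 0%N); pose Lb := moment_form (g 0%N).
have form_ge0 (F G : {poly R}) : (size F <= M.+1)%N -> (size G <= M.+1)%N ->
    F`_0 = G`_0 -> F`_0 ^+ 2 * c <= La (F * F) + Lb (G * G).
  exact: axes_form_ge0.
have sC (x : R) : (size x%:P <= M.+1)%N by rewrite (leq_trans (size_polyC_leq1 _)).
have scale s (F : {poly R}) : F`_0 != 0 ->
    moment_form s (F * F) =
      F`_0 ^+ 2 * moment_form s (((F`_0)^-1 *: F) * ((F`_0)^-1 *: F)).
  move=> F0; rewrite -scalerAl -scalerAr !linearZ /=; by field.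
pose A := [set La (F * F) | F in
  [set F : {poly R} | (size F <= M.+1)%N /\ F`_0 = 1]]%classic.
have A_ge (G : {poly R}) : (size G <= M.+1)%N -> G`_0 = 1 ->
    lbound A (c - Lb (G * G)).
  move=> GM G1 _ [f [fM f1] <-].
  by rewrite lerBlDr (le_trans _ (form_ge0 f G fM GM _)) ?f1 ?G1 // expr1n mul1r.
have A0 : (A !=set0)%classic.
  by exists (La (1%:P * 1%:P)), 1%:P => //; split; rewrite ?sC // coefC.
have lbA : has_lbound A.
  by exists (c - Lb (1%:P * 1%:P)); apply: A_ge; rewrite ?sC // coefC.
pose kappa := inf A.
have [F FM|nua nuaP aE] := @truncated_hamburger R
    (fun i => g i 0%N - (i == 0)%:R * kappa) M.
  rewrite moment_form_lower coef0M -[_`_0 * _]expr2.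
  have [F0|F0] := eqVneq F`_0 0.
    rewrite F0 expr0n mul0r subr0; have := form_ge0 F 0 FM.
    by rewrite size_poly0 coef0 F0 expr0n /= !mul0r /Lb linear0 addr0; apply.
  rewrite scale // -mulrBr mulr_ge0 ?sqr_ge0 // subr_ge0; apply: ge_inf => //.
  exists ((F`_0)^-1 *: F) => //; split; last by rewrite coefZ mulVf.
  by rewrite (leq_trans (size_scale_leq _ _)).
have [G GM|nub nubP bE] := @truncated_hamburger R
    (fun j => g 0%N j - (j == 0)%:R * (c - kappa)) M.
  rewrite moment_form_lower coef0M -[_`_0 * _]expr2.
  have [G0|G0] := eqVneq G`_0 0.
    rewrite G0 expr0n mul0r subr0; have := form_ge0 0 G _ GM.
    by rewrite size_poly0 coef0 G0 expr0n /= !mul0r /La linear0 add0r; apply.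
  rewrite scale // -mulrBr mulr_ge0 ?sqr_ge0 // subr_ge0 lerBlDr addrC -lerBlDr.
  apply: lb_le_inf => //; apply: A_ge; last by rewrite coefZ mulVf.
  by rewrite (leq_trans (size_scale_leq _ _)).
exists ([seq (a.1, (a.2, 0)) | a <- nua] ++ [seq (a.1, (0, a.2)) | a <- nub]).
  move=> a; rewrite mem_cat => /orP[] /mapP[a' /[dup] ? aP -> /=].
    by rewrite mulr0; split=> //; exact: nuaP.
  by rewrite mul0r; split=> //; exact: nubP.
move=> i j ijn; rewrite big_cat !big_map /=.
have -> : \sum_(a <- nua) a.1 * (a.2 ^+ i * 0 ^+ j) =
    (j == 0)%:R * (g i 0%N - (i == 0)%:R * kappa).
  rewrite aE; last by lia.
  by rewrite mulr_sumr; apply: eq_bigr => a _; rewrite expr0n mulrA mulrC.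
have -> : \sum_(a <- nub) a.1 * (0 ^+ i * a.2 ^+ j) =
    (i == 0)%:R * (g 0%N j - (j == 0)%:R * (c - kappa)).
  rewrite bE; last by lia.
  by rewrite mulr_sumr; apply: eq_bigr => a _; rewrite expr0n mulrCA.
case: i j ijn => [|i] [|j] ijn; rewrite /= ?(mul0r, mul1r, subr0, addr0, add0r) //.
  by rewrite /c; lra.
by apply: g0; lia.
Qed.

(** The splitting by the idempotent [x^l1 y^l2]: multiplication by it shifts the
    exponents by [(l1, l2)]. *)
Lemma plane_moments_atomic (R : realType) (l1 l2 n : nat) (g : nat -> nat -> R) :
  (1 < l1)%N -> (1 < l2)%N -> coprime l1 l2 ->
  let N := (n + 2 * (l1 + l2))%N in
  psd_upto N g ->
  (forall i j, (i + j + (l1 + l2) + 3 <= 2 * N)%N ->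
    g (i.+1 + l1)%N (j.+1 + l2)%N = g i.+1 j.+1) ->
  atomic_upto (fun x y => x * y * (x ^+ l1 * y ^+ l2 - 1) = 0) (2 * n) g.
Proof.
move=> h1 h2 co N pos rel; pose M := (n + l1 + l2 - 2)%N.
pose gC i j := g (i + l1)%N (j + l2)%N.
have idem i j : (i + j <= 2 * M)%N -> gC (i + l1)%N (j + l2)%N = gC i j.
  move=> ijM; rewrite /gC.
  have -> : (i + l1 = (i + l1).-1.+1)%N by lia.
  have -> : (j + l2 = (j + l2).-1.+1)%N by lia.
  by apply: rel; rewrite /N; lia.
have degD (I : finType) (i j : I -> nat) (a b : I) :
    (forall a, i a + j a <= M)%N -> (i a + i b + (j a + j b) <= 2 * M)%N.
  by move=> ijM; have := ijM a; have := ijM b; lia.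
apply: (@atomic_uptoD R (fun x y => x * y = 0) (fun x y => x ^+ l1 * y ^+ l2 = 1)
  _ _ (fun i j => g i j - gC i j) gC).
- by move=> x y ->; rewrite mul0r.
- by move=> x y ->; rewrite subrr mulr0.
- by move=> i j _; rewrite subrK.
- apply: (@axes_moments_atomic R M); first by rewrite /M; lia.
    move=> I c i j ijM.
    (* The polynomial [(1 - e) f], as the family of [f] followed by that of [- e f]. *)
    have := pos (I + I)%type
      (fun a => match a with inl a => c a | inr a => - c a end)
      (fun a => match a with inl a => i a | inr a => (i a + l1)%N end)
      (fun a => match a with inl a => j a | inr a => (j a + l2)%N end).
    rewrite big_sumType /= -big_split /=.
    set S := \sum_a _; set S' := \sum_a _.
    have -> : S = S'.
      apply: eq_bigr => a _; rewrite !big_sumType /= -!big_split.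
      apply: eq_bigr => b _ /=.
      have := idem _ _ (degD _ i j a b ijM); rewrite /gC.
      have -> : (i a + i b + l1 + l1 = i a + l1 + (i b + l1))%N by lia.
      have -> : (j a + j b + l2 + l2 = j a + l2 + (j b + l2))%N by lia.
      have -> : (i a + l1 + i b = i a + i b + l1)%N by lia.
      have -> : (j a + l2 + j b = j a + j b + l2)%N by lia.
      rewrite !addnA => ->; ring.
    by apply; case=> a; have := ijM a; rewrite /M /N /=; lia.
  move=> i j ijM; rewrite /gC rel ?subrr //; rewrite /N; lia.
- apply: curve_moments_atomic => // [I c i j ijM|i j ijM]; last first.
    by apply: idem; lia.
  have := pos I c (fun a => i a + l1)%N (fun a => j a + l2)%N.
  set S := \sum_a _; set S' := \sum_a _.
  have -> : S = S'.
    apply: eq_bigr => a _; apply: eq_bigr => b _.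
    rewrite -(idem _ _ (degD _ i j a b ijM)) /gC.
    by congr (_ * g _ _); lia.
  by apply=> a; have := ijM a; rewrite /N; lia.
Qed.

(** * Moment matrices and Riesz functionals *)

Definition mono {R : nzRingType} (i j : nat) : bipoly R := polX ^+ i * polY ^+ j.

Lemma monoM (R : comNzRingType) (i j i' j' : nat) :
  mono i j * mono i' j' = mono (i + i') (j + j') :> bipoly R.
Proof. by rewrite /mono !exprD mulrACA. Qed.

Lemma monE (R : comNzRingType) (m : nat) (u : monomials m) :
  mon u = mono (bmnm u ord0) (bmnm u ord_max) :> bipoly R.
Proof.
rewrite /mon mpolyXE_id !big_ord_recl big_ord0 mulr1 /mono /polX /polY.
by congr (_ * mpolyX _ (mnm1 _) ^+ bmnm u _); apply: val_inj.
Qed.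

Lemma mdeg2 (u : multinom 2) : mdeg u = (u ord0 + u ord_max)%N.
Proof.
rewrite mdegE !big_ord_recl big_ord0 addn0; congr (_ + u _)%N.
exact: val_inj.
Qed.

Lemma monomial_of_exponents (m i j : nat) : (i + j <= m)%N ->
  exists u : monomials m, bmnm u ord0 = i /\ bmnm u ord_max = j.
Proof.
move=> ijm; pose t := mnm_add (mnm_muln (mnm1 (ord0 : 'I_2)) i) (mnm_muln (mnm1 ord_max) j).
have t0 : t ord0 = i by rewrite mnmDE !mulmnE !mnm1E /= mul1n mul0n addn0.
have t1 : t ord_max = j by rewrite mnmDE !mulmnE !mnm1E /= mul1n mul0n.
have tm : (mdeg t < m.+1)%N by rewrite mdeg2 t0 t1.
by exists (BMultinom tm).
Qed.

Lemma msize_mono (R : comNzRingType) (i j : nat) :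
  msize (mono i j : bipoly R) = (i + j).+1.
Proof.
have [u [ui uj]] := monomial_of_exponents (leqnn (i + j)).
have -> : mono i j = mon u :> bipoly R by rewrite monE ui uj.
by rewrite /mon msizeX mdeg2 ui uj.
Qed.

Lemma riesz_is_linear (R : realType) (n : nat) (beta : trunc_seq R n) :
  linear_for *%R (riesz beta).
Proof.
move=> a p q; rewrite /riesz mulr_sumr -big_split; apply: eq_bigr => m _ /=.
by rewrite mcoeffD mcoeffZ mulrDl mulrA.
Qed.

HB.instance Definition _ (R : realType) (n : nat) (beta : trunc_seq R n) :=
  GRing.isLinear.Build R (bipoly R) R *%R (riesz beta) (riesz_is_linear beta).

Lemma riesz_mon (R : realType) (n : nat) (beta : trunc_seq R n)
    (u : monomials (2 * n)) : riesz beta (mon u) = beta u.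
Proof.
rewrite /riesz (bigD1 u) //= big1 ?addr0.
  by rewrite /mon mcoeffX eqxx mul1r.
move=> m mu; rewrite /mon mcoeffX (_ : _ == _ = false) ?mul0r //.
by apply/negbTE; rewrite eq_sym -bmeqP.
Qed.

(** The common form of moment and localizing matrices, the functional [L] being
    the Riesz functional or its composition with a multiplication. *)
Definition gram_matrix {R : realType} (m : nat) (L : bipoly R -> R) :
    'M[R]_#|{: monomials m}| :=
  \matrix_(i, j) L (mon (enum_val i) * mon (enum_val j)).

Lemma gram_matrix_form (R : realType) (m : nat) (L : {linear bipoly R -> R | *%R})
    (v : 'cV[R]_#|{: monomials m}|) :
  let f := \sum_i v i 0 *: mon (enum_val i) in
  (v^T *m gram_matrix m L *m v) 0 0 = L (f * f).
Proof.
move=> f; rewrite mxE /f mulr_sumr linear_sum; apply: eq_bigr => j _ /=.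
rewrite mxE -scalerAr linearZ /= mulrC; congr (_ * _).
rewrite mulr_suml linear_sum; apply: eq_bigr => i _ /=.
by rewrite -scalerAl linearZ /= !mxE.
Qed.

(** The quadratic form of the matrix at a vector [v] is [L (f * f)], where [f] has
    the coefficients [v]. *)
Lemma gram_matrix_psd (R : realType) (m : nat) (L : {linear bipoly R -> R | *%R}) :
  psd (gram_matrix m L) <->
  forall f : bipoly R, (msize f <= m.+1)%N -> 0 <= L (f * f).
Proof.
split=> [[_ pos] f fm|pos].
  pose v : 'cV[R]_#|{: monomials m}| := \col_i mcoeff (bmnm (enum_val i)) f.
  have := pos v; rewrite gram_matrix_form; congr (0 <= L (_ * _)).
    rewrite [RHS](mpolywE fm) [RHS](reindex_onto enum_val enum_rank) /=; last first.
      by move=> u _; rewrite enum_rankK.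
    by apply: eq_big => [i|i _]; rewrite ?enum_valK ?eqxx // mxE.
  rewrite [RHS](mpolywE fm) [RHS](reindex_onto enum_val enum_rank) /=; last first.
    by move=> u _; rewrite enum_rankK.
  by apply: eq_big => [i|i _]; rewrite ?enum_valK ?eqxx // mxE.
split=> [|v].
  by apply/matrixP => i j; rewrite !mxE mulrC.
rewrite gram_matrix_form; apply: pos.
rewrite (leq_trans (msize_sum _ _ _)) //; apply/bigmax_leqP => i _.
rewrite (leq_trans (msizeZ_le _ _)) // /mon msizeX ltnS.
by rewrite -ltnS bmdeg.
Qed.

Lemma msizeM_pred (R : idomainType) (p q : bipoly R) :
  (msize (p * q) <= (msize p + msize q).-1)%N.
Proof.
have [->|p0] := eqVneq p 0; first by rewrite mul0r msize0.
have [->|q0] := eqVneq q 0; first by rewrite mulr0 msize0.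
by rewrite msizeM.
Qed.

Definition localized_riesz {R : realType} {n : nat} (beta : trunc_seq R n)
    (q f : bipoly R) : R := riesz beta (q * f).

Lemma localized_riesz_is_linear (R : realType) (n : nat) (beta : trunc_seq R n)
    (q : bipoly R) : linear_for *%R (localized_riesz beta q).
Proof.
by move=> a f g; rewrite /localized_riesz mulrDr -scalerAr linearD linearZ.
Qed.

HB.instance Definition _ (R : realType) (n : nat) (beta : trunc_seq R n) (q : bipoly R) :=
  GRing.isLinear.Build R (bipoly R) R *%R (localized_riesz beta q)
    (localized_riesz_is_linear beta q).

Lemma moment_matrix_psd (R : realType) (n : nat) (beta : trunc_seq R n) :
  psd (moment_matrix beta) <->
  forall f : bipoly R, (msize f <= n.+1)%N -> 0 <= riesz beta (f * f).
Proof. exact: (gram_matrix_psd n (riesz beta)). Qed.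

Lemma localizing_matrix_psd (R : realType) (n : nat) (beta : trunc_seq R n)
    (q : bipoly R) :
  psd (localizing_matrix beta q) <->
  forall f : bipoly R, (msize f <= (n - uphalf (deg q)).+1)%N ->
    0 <= riesz beta (q * (f * f)).
Proof.
rewrite -(gram_matrix_psd _ (localized_riesz beta q)).
suff -> : localizing_matrix beta q =
  gram_matrix (n - uphalf (deg q)) (localized_riesz beta q) by [].
by apply/matrixP => i j; rewrite !mxE /localized_riesz mulrA.
Qed.

Lemma moment_matrix_psd_upto (R : realType) (n : nat) (beta : trunc_seq R n) :
  psd (moment_matrix beta) -> psd_upto n (fun i j => riesz beta (mono i j)).
Proof.
move=> /moment_matrix_psd pos I c i j ijn.
pose f : bipoly R := \sum_a c a *: mono (i a) (j a).
have fn : (msize f <= n.+1)%N.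
  rewrite (leq_trans (msize_sum _ _ _)) //; apply/bigmax_leqP => a _.
  by rewrite (leq_trans (msizeZ_le _ _)) // msize_mono ltnS.
have := pos f fn; rewrite mulr_suml linear_sum.
under eq_bigr do rewrite mulr_sumr linear_sum /=.
by under eq_bigr do under eq_bigr do
  rewrite -scalerAl -scalerAr scalerA linearZ /= monoM.
Qed.

(** Both signs give [L (q f^2) = 0], and polarization gives [L (q f g) = 0]; every
    monomial of the degree in question is a product of two admissible ones. *)
Lemma localizing_vanish (R : realType) (n : nat) (beta : trunc_seq R n)
    (q : bipoly R) :
  psd (localizing_matrix beta q) -> psd (localizing_matrix beta (- q)) ->
  forall i j, (i + j <= 2 * (n - uphalf (deg q)))%N ->
    riesz beta (q * mono i j) = 0.
Proof.
move=> /localizing_matrix_psd pos /localizing_matrix_psd.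
rewrite /deg msizeN -/(deg q) => neg; set h := (n - _)%N in pos neg *.
have sq0 (f : bipoly R) : (msize f <= h.+1)%N -> riesz beta (q * (f * f)) = 0.
  move=> fh; apply/eqP; rewrite eq_le pos // andbT -oppr_ge0 -linearN /= -mulNr.
  exact: neg.
move=> i j ijh.
have [a [b [ah bh -> ->]]] : exists a b : nat * nat, [/\ (a.1 + a.2 <= h)%N,
    (b.1 + b.2 <= h)%N, i = (a.1 + b.1)%N & j = (a.2 + b.2)%N].
  have [ih|hi] := leqP i h.
    exists (i, minn j (h - i))%N, (0, j - minn j (h - i))%N => /=; split; lia.
  by exists (h, 0)%N, (i - h, j)%N => /=; split; lia.
have fh : (msize (mono a.1 a.2 : bipoly R) <= h.+1)%N by rewrite msize_mono.
have gh : (msize (mono b.1 b.2 : bipoly R) <= h.+1)%N by rewrite msize_mono.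
rewrite -monoM; set f := mono a.1 a.2 in fh *; set g := mono b.1 b.2 in gh *.
have fgh : (msize (f + g) <= h.+1)%N.
  by rewrite (leq_trans (msizeD_le _ _)) // geq_max fh gh.
have := sq0 (f + g) fgh.
have -> : q * ((f + g) * (f + g)) = q * (f * f) + q * (g * g) + (q * (f * g)) *+ 2.
  by ring.
rewrite 2!linearD /= raddfMn /= !sq0 // !add0r => /eqP.
by rewrite mulrn_eq0 /= => /eqP.
Qed.

Lemma positive_extension_riesz (R : realType) (n k : nat) (beta : trunc_seq R n)
    (gamma : trunc_seq R (n + k)) (i j : nat) :
  mxsub (@widen_index n k) (@widen_index n k) (moment_matrix gamma) =
    moment_matrix beta ->
  (i + j <= 2 * n)%N -> riesz beta (mono i j) = riesz gamma (mono i j).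
Proof.
move=> ext ijn.
have [a [b [ah bh -> ->]]] : exists a b : nat * nat, [/\ (a.1 + a.2 <= n)%N,
    (b.1 + b.2 <= n)%N, i = (a.1 + b.1)%N & j = (a.2 + b.2)%N].
  have [ih|hi] := leqP i n.
    exists (i, minn j (n - i))%N, (0, j - minn j (n - i))%N => /=; split; lia.
  by exists (n, 0)%N, (i - n, j)%N => /=; split; lia.
have [u [u1 u2]] := monomial_of_exponents ah.
have [v [v1 v2]] := monomial_of_exponents bh.
move/matrixP/(_ (enum_rank u) (enum_rank v)): ext.
rewrite !mxE /widen_index !enum_rankK !monE /= u1 u2 v1 v2 !monoM.
by move=> ->.
Qed.

Lemma evalp_mon (R : realType) (m : nat) (u : monomials m) (z : plane R) :
  evalp (mon u) z = z.1 ^+ bmnm u ord0 * z.2 ^+ bmnm u ord_max.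
Proof.
rewrite /evalp /mon mevalX !big_ord_recl big_ord0 mulr1 /=.
by congr (_ * _ ^+ bmnm u _); apply: val_inj.
Qed.

Lemma riesz_atomic (R : realType) (n : nat) (beta : trunc_seq R n)
    (nu : seq (R * plane R)) :
  (forall u, beta u = \sum_(a <- nu) a.1 * evalp (mon u) a.2) ->
  forall q : bipoly R, (msize q <= (2 * n).+1)%N ->
    riesz beta q = \sum_(a <- nu) a.1 * evalp q a.2.
Proof.
move=> betaE q qn; rewrite /riesz.
under eq_bigr do rewrite betaE mulr_sumr.
rewrite exchange_big; apply: eq_bigr => a _ /=.
rewrite {2}(mpolywE qn) /evalp linear_sum mulr_sumr; apply: eq_bigr => u _ /=.
by rewrite mevalZ mulrCA.
Qed.

Lemma atomic_moments_psd (R : realType) (n : nat) (beta : trunc_seq R n)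
    (nu : seq (R * plane R)) :
  (forall u, beta u = \sum_(a <- nu) a.1 * evalp (mon u) a.2) ->
  (forall a, a \in nu -> 0 <= a.1) -> psd (moment_matrix beta).
Proof.
move=> betaE nu_ge0; apply/moment_matrix_psd => f fn.
rewrite (riesz_atomic betaE) ?(leq_trans (msizeM_pred _ _)) //; last first.
  by move: fn; move: (msize f) => sf; lia.
rewrite big_seq sumr_ge0 // => a /nu_ge0 a_ge0.
by rewrite mulr_ge0 // /evalp mevalM -expr2 sqr_ge0.
Qed.

Lemma uphalf_bounds (x : nat) : (x <= 2 * uphalf x <= x.+1)%N.
Proof. by have := odd_double_half x; rewrite uphalf_half -mul2n; lia. Qed.

(** If the degree of [q] exceeded [2 n], the index set of the localizing matrix,
    cut off at degree 0, would still involve moments of order above [2 n]. *)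
Lemma atomic_localizing_psd (R : realType) (n : nat) (beta : trunc_seq R n)
    (nu : seq (R * plane R)) (q : bipoly R) :
  (forall u, beta u = \sum_(a <- nu) a.1 * evalp (mon u) a.2) ->
  (forall a, a \in nu -> evalp q a.2 = 0) -> (deg q <= 2 * n)%N ->
  psd (localizing_matrix beta q).
Proof.
move=> betaE nu_q qn; apply/localizing_matrix_psd => f fn.
rewrite (riesz_atomic betaE) ?(leq_trans (msizeM_pred _ _)) //.
  rewrite big_seq sumr_ge0 // => a /nu_q az.
  by rewrite /evalp mevalM -/(evalp q _) az mul0r mulr0.
have := msizeM_pred f f; move: qn fn; rewrite /deg.
have := uphalf_bounds (msize q).-1.
by move: (uphalf (msize q).-1) (msize q) (msize f) (msize (f * f)) => u sq sf sff; lia.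
Qed.

(** Dirac measures are added one at a time, tracking only integrals of nonnegative
    functions, for which no integrability is required; the general case follows
    by splitting into positive and negative parts. *)
Lemma atomic_measure (d : measure_display) (T : measurableType d) (R : realType)
    (nu : seq (R * T)) : (forall a, a \in nu -> 0 <= a.1) ->
  exists mu : {measure set T -> \bar R},
    (forall A, measurable A -> (forall a, a \in nu -> ~ A a.2) -> mu A = 0%E) /\
    forall f : T -> R, measurable_fun setT f ->
      mu.-integrable setT (EFin \o f) /\
      (\int[mu]_z (f z)%:E)%E = (\sum_(a <- nu) a.1 * f a.2)%:E.
Proof.
move=> nu_ge0.
have [mu [mu0 muE]] : exists mu : {measure set T -> \bar R},
    (forall A, measurable A -> (forall a, a \in nu -> ~ A a.2) -> mu A = 0%E) /\
    forall f : T -> R, measurable_fun setT f -> (forall z, 0 <= f z) ->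
      (\int[mu]_z (f z)%:E)%E = (\sum_(a <- nu) a.1 * f a.2)%:E.
  elim: nu nu_ge0 => [|[w z] nu IHnu] nu_ge0.
    exists mzero; split=> // f mf f0.
    by rewrite integral_measure_zero big_nil.
  have [a anu|mu [mu0 muE]] := IHnu; first by apply: nu_ge0; rewrite inE anu orbT.
  have w0 : 0 <= w by apply: (nu_ge0 (w, z)); rewrite inE eqxx.
  exists (measure_add (mscale (NngNum w0) (dirac z)) mu); split=> [A mA Anu|f mf f0].
    rewrite -[LHS]/(measure_add (mscale (NngNum w0) (dirac z)) mu A) measure_addE.
    rewrite mu0 // => [|a anu]; last by apply: Anu; rewrite inE anu orbT.
    rewrite adde0 -[LHS]/(w%:E * \d_z A)%E diracE (_ : z \in A = false) ?mule0 //.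
    by apply/negP; rewrite inE; apply: (Anu (w, z)); rewrite inE eqxx.
  have mEf : measurable_fun setT (EFin \o f) by apply/measurable_EFinP.
  have f0E z' : setT z' -> (0 <= (f z')%:E)%E by rewrite lee_fin.
  rewrite ge0_integral_measure_add // (muE f) // ge0_integral_mscale //.
  by rewrite integral_dirac // diracT mul1e big_cons EFinD EFinM.
exists mu; split=> // f mf.
have mEf : measurable_fun setT (EFin \o f) by apply/measurable_EFinP.
have mp : measurable_fun setT (f^\+)%R by exact: measurable_funrpos.
have mn : measurable_fun setT (f^\-)%R by exact: measurable_funrneg.
split.
  apply/integrableP; split=> //=.
  under eq_integral do rewrite /=.
  rewrite (muE (fun z => `|f z|)) ?ltry //.
  exact: measurableT_comp.
rewrite integralE -[(fun x => (f x)%:E)]/(EFin \o f) funerpos funerneg.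
rewrite (muE (f^\+)%R) // (muE (f^\-)%R) //.
rewrite -EFinB -sumrB; congr EFin; apply: eq_bigr => a _.
by rewrite -mulrBr -[in RHS](funrposBneg f).
Qed.

(** * The generator family of the axes and the curve *)

Definition curve_axes_poly (R : realType) (l1 l2 : nat) : bipoly R :=
  polX * polY * (polX ^+ l1 * polY ^+ l2 - 1).

Lemma curve_axes_polyE (R : realType) (l1 l2 : nat) :
  curve_axes_poly R l1 l2 = mono l1.+1 l2.+1 - mono 1 1.
Proof. by rewrite /curve_axes_poly /mono !exprS !expr0; ring. Qed.

Lemma deg_curve_axes_poly (R : realType) (l1 l2 : nat) :
  (deg (curve_axes_poly R l1 l2) <= l1 + l2 + 2)%N.
Proof.
rewrite curve_axes_polyE /deg -subn1 leq_subLR (leq_trans (msizeD_le _ _)) //.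
by rewrite msizeN !msize_mono geq_max; lia.
Qed.

Lemma evalp_curve_axes_poly (R : realType) (l1 l2 : nat) (z : plane R) :
  evalp (curve_axes_poly R l1 l2) z = z.1 * z.2 * (z.1 ^+ l1 * z.2 ^+ l2 - 1).
Proof.
by rewrite /evalp /curve_axes_poly !(mevalM, mevalB, meval1) !rmorphXn /= !mevalXU.
Qed.

Lemma semialg_zero_set (R : realType) (q : bipoly R) :
  semialg [:: 1; q; - q] = [set z | evalp q z = 0]%classic.
Proof.
apply/seteqP; split=> z /= h.
  apply/eqP; rewrite eq_le h ?andbT ?inE ?eqxx ?orbT //.
  by rewrite -oppr_ge0 -mevalN; apply: h; rewrite !inE eqxx !orbT.
move=> f; rewrite !inE => /or3P[] /eqP ->.
- by rewrite /evalp meval1.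
- by rewrite h.
- by rewrite /evalp mevalN -/(evalp q z) h oppr0.
Qed.

Lemma measurable_monomial (R : realType) (i j : nat) :
  measurable_fun setT (fun z : plane R => z.1 ^+ i * z.2 ^+ j : R).
Proof.
apply: measurable_funM; apply: measurable_funX; [exact: measurable_fst|exact: measurable_snd].
Qed.

Lemma measurable_zero_set (R : realType) (l1 l2 : nat) :
  measurable [set z : plane R | evalp (curve_axes_poly R l1 l2) z = 0]%classic.
Proof.
pose f (z : plane R) : R := z.1 ^+ l1.+1 * z.2 ^+ l2.+1 - z.1 ^+ 1 * z.2 ^+ 1.
have mf : measurable_fun setT f.
  by apply: measurable_funB; exact: measurable_monomial.
rewrite (_ : [set z | _]%classic = (setT `&` f @^-1` [set 0])%classic).
  exact: mf.
rewrite setTI; apply/seteqP; split=> z /=; rewrite evalp_curve_axes_poly /f => <-;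
  by rewrite !exprS !expr0; ring.
Qed.

Lemma extension_of_measure (R : realType) (l1 l2 n k : nat) (beta : trunc_seq R n)
    (mu : {measure set (plane R) -> \bar R}) :
  let p := curve_axes_poly R l1 l2 in
  (deg p <= 2 * (n + k))%N -> representing_measure [:: 1; p; - p] beta mu ->
  exists gamma : trunc_seq R (n + k), [/\ positive_extension beta gamma,
    psd (localizing_matrix gamma p) & psd (localizing_matrix gamma (- p))].
Proof.
move=> p pn; rewrite /representing_measure semialg_zero_set => -[mu0 muE].
have [nu nuP nuE] := @integral_atomic _ (plane R) R mu _
  (fun (i : 'I_#|{: monomials (2 * n)}|) z =>
     z.1 ^+ bmnm (enum_val i) ord0 * z.2 ^+ bmnm (enum_val i) ord_max)
  _ (@measurable_zero_set R l1 l2) mu0 (fun i => (muE (enum_val i)).1).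
have betaE u : beta u = \sum_(a <- nu) a.1 * evalp (mon u) a.2.
  apply: EFin_inj; rewrite -(muE u).2.
  have := nuE (enum_rank u); rewrite enum_rankK => ->; congr EFin.
  by apply: eq_bigr => a _; rewrite evalp_mon.
have nu_ge0 a : a \in nu -> 0 <= a.1 by move=> /nuP[].
have nu_p a : a \in nu -> evalp p a.2 = 0 by move=> /nuP[].
pose gamma : trunc_seq R (n + k) := fun u => \sum_(a <- nu) a.1 * evalp (mon u) a.2.
have gammaE u : gamma u = \sum_(a <- nu) a.1 * evalp (mon u) a.2 by [].
exists gamma; split.
- split; first exact: (atomic_moments_psd gammaE).
  apply/matrixP => i j; rewrite !mxE /widen_index !enum_rankK.
  have szm (u v : monomials n) : (msize (mon u * mon v : bipoly R) <= (2 * n).+1)%N.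
    rewrite !monE monoM msize_mono ltnS.
    by have := bmdeg u; have := bmdeg v; rewrite !mdeg2; lia.
  rewrite (riesz_atomic betaE) ?(riesz_atomic gammaE) //.
  by apply: leq_trans (szm _ _) _; lia.
- exact: (atomic_localizing_psd gammaE).
- apply: (atomic_localizing_psd gammaE); last by rewrite /deg msizeN.
  by move=> a /nu_p; rewrite /evalp mevalN => ->; rewrite oppr0.
Qed.

Lemma measure_of_extension (R : realType) (l1 l2 n : nat) (beta : trunc_seq R n)
    (gamma : trunc_seq R (n + 2 * (l1 + l2))) :
  let p := curve_axes_poly R l1 l2 in
  (1 < l1)%N -> (1 < l2)%N -> coprime l1 l2 -> positive_extension beta gamma ->
  psd (localizing_matrix gamma p) -> psd (localizing_matrix gamma (- p)) ->
  exists mu : {measure set (plane R) -> \bar R},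
    representing_measure [:: 1; p; - p] beta mu.
Proof.
move=> p h1 h2 co [pos ext] locp locn.
have [|nu nuP nuE] := @plane_moments_atomic R l1 l2 n
    (fun i j => riesz gamma (mono i j)) h1 h2 co (moment_matrix_psd_upto pos).
  move=> i j ijN; apply/eqP; rewrite -subr_eq0 -linearB /=; apply/eqP.
  have -> : mono (i.+1 + l1) (j.+1 + l2) - mono i.+1 j.+1 = p * mono i j.
    rewrite /p curve_axes_polyE mulrBl !monoM.
    by congr (mono _ _ - mono _ _); lia.
  apply: (localizing_vanish locp locn).
  have := uphalf_bounds (deg p); have := deg_curve_axes_poly R l1 l2.
  by rewrite -/p; move: (deg p) (uphalf _) => dp u; lia.
have nu_ge0 a : a \in nu -> 0 <= a.1 by move=> /nuP[].
have [mu [mu0 muE]] := @atomic_measure _ (plane R) R nu nu_ge0.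
exists mu; split=> [|u].
  rewrite semialg_zero_set; apply: mu0.
    by apply: measurableC; exact: measurable_zero_set.
  by move=> a /nuP[_ az] /=; apply; rewrite evalp_curve_axes_poly.
have [intu intuE] := muE _ (@measurable_monomial R (bmnm u ord0) (bmnm u ord_max)).
split=> //; rewrite intuE -nuE.
  by rewrite -(positive_extension_riesz ext) -?monE ?riesz_mon // -mdeg2 -ltnS bmdeg.
by rewrite -mdeg2 -ltnS bmdeg.
Qed.

Theorem theorem4p4 (R : realType) (l1 l2 : nat)
    (hl1 : (1 < l1)%N) (hl2 : (1 < l2)%N) (hgcd : gcdn l1 l2 = 1%N)
    (n : nat) (hn : (l1 + l2 + 2 <= n)%N) :
  let p : bipoly R := polX * polY * (polX ^+ l1 * polY ^+ l2 - 1) in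
  property_S [:: 1; p; - p] n (2 * (l1 + l2)).
Proof.
move=> p beta; split=> [[mu]|[gamma [ext loc]]].
  move=> /(@extension_of_measure R l1 l2 n (2 * (l1 + l2))) [].
    by rewrite (leq_trans (deg_curve_axes_poly R l1 l2)) //; lia.
  by move=> gamma [ext locp locn]; exists gamma; split=> // -[|[|[|i]]].
apply: (@measure_of_extension R l1 l2 n beta gamma) => //.
- by rewrite /coprime hgcd.
- exact: (loc 1%N).
- exact: (loc 2%N).
Qed.
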